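(* Let $n\ge 1$. There is an isomorphism of $\mathrm{TL}_n$-modules $$\bigoplus_{0\le k\le n}\operatorname{Ind}_{\mathrm{TL}_k\otimes \mathrm{TL}_{n-k}}^{\mathrm{TL}_n}\mathbb K_{\mathrm{triv}}\;\cong\; V^{\otimes n}$$ which identifies the diagrammatic basis of the left-hand side (the union over $k$ of the diagrammatic bases of the summands) with the dual canonical basis of $V^{\otimes n}$.
   Context: Let $q$ be an indeterminate, $\mathbb K=\mathbb C(q)$, and let $a\mapsto\bar a$ be the $\mathbb C$-linear field automorphism of $\mathbb K$ with $\bar q=q^{-1}$. Temperley-Lieb algebra. An $n$-diagram consists of two parallel horizontal lines (bottom and top) with $n$ vertices each, numbered from left to right, the $2n$ vertices being joined in pairs by pairwise non-crossing edges (''links'') drawn between the lines, up to homotopy. $\mathrm{TL}_n$ is the $\mathbb K$-algebra with basis the $n$-diagrams; the product $D'D$ is obtained by stacking $D'$ on top of $D$ and replacing each closed loop by the factor $\beta=-q-q^{-1}$. It is generated by $e_1,\dots,e_{n-1}$, where $e_i$ joins vertices $i,i+1$ on the bottom line, joins vertices $i,i+1$ on the top line, and has vertical links elsewhere. Action. $V=\mathbb K v_+\oplus\mathbb K v_-$ (denoted $\mathbb C^2$ in the literature). Let $\epsilon:V\otimes V\to\mathbb K$, $v_+\otimes v_+\mapsto 0$, $v_+\otimes v_-\mapsto -q$, $v_-\otimes v_+\mapsto 1$, $v_-\otimes v_-\mapsto 0$, and $\delta:\mathbb K\to V\otimes V$, $1\mapsto v_+\otimes v_- -q^{-1}v_-\otimes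 v_+$. $\mathrm{TL}_n$ acts on $V^{\otimes n}$ by $e_i\mapsto \mathrm{id}^{\otimes(i-1)}\otimes(\delta\circ\epsilon)\otimes\mathrm{id}^{\otimes(n-i-1)}$. Induced modules. $\mathrm{TL}_k\otimes\mathrm{TL}_{n-k}\subseteq\mathrm{TL}_n$ is the subalgebra generated by the $e_i$ with $i\ne k$; $\mathbb K_{\mathrm{triv}}$ is its one-dimensional module on which all these $e_i$ act by $0$; $\operatorname{Ind}$ denotes $\mathrm{TL}_n\otimes_{\mathrm{TL}_k\otimes\mathrm{TL}_{n-k}}(-)$. The diagrammatic basis of $\operatorname{Ind}_{\mathrm{TL}_k\otimes\mathrm{TL}_{n-k}}^{\mathrm{TL}_n}\mathbb K_{\mathrm{triv}}$ consists of the elements $D\otimes1$, where $D$ runs over the $n$-diagrams having no link joining two of the first $k$ bottom vertices and no link joining two of the last $n-k$ bottom vertices. Dual canonical basis. Let $K,E,F$ act on $V$ by $K v_\pm=q^{\pm1}v_\pm$, $Ev_+=0$, $Ev_-=v_+$, $Fv_+=v_-$, $Fv_-=0$, and let $F$ act on $V^{\otimes m}$ by $\sum_{j=1}^m 1^{\otimes(j-1)}\otimes F\otimes K^{\otimes(m-j)}$. The bar involution $\psi_m$ of $V^{\otimes m}$ is the antilinear map ($\psi_m(ax)=\bar a\psi_m(x)$) determined by $\psi_1(v_\pm)=v_\pm$ and $\psi_m(x\otimes v)=\psi_{m-1}(x)\otimes v+(q-q^{-1})\,F\psi_{m-1}(x)\otimes Ev$ for $x\in V^{\otimes(m-1)}$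 and $v\in\{v_+,v_-\}$. For $k_n,\dots,k_1\in\{+,-\}$, $v_{k_n}\heartsuit\cdots\heartsuit v_{k_1}\in V^{\otimes n}$ is the unique element such that (i) it is fixed by $\psi_n$; (ii) $v_{k_n}\heartsuit\cdots\heartsuit v_{k_1}-v_{k_n}\otimes\cdots\otimes v_{k_1}$ is a $q^{-1}\mathbb Z[q^{-1}]$-linear combination of vectors $v_{l_n}\otimes\cdots\otimes v_{l_1}$; (iii) these vectors satisfy $\sum_{i=1}^n l_i=\sum_{i=1}^n k_i$ and $\sum_{i=1}^{n'}l_i\ge\sum_{i=1}^{n'}k_i$ for $1\le n'\le n$ (reading $\pm$ as $\pm1$). The dual canonical basis of $V^{\otimes n}$ is the set of all $v_{k_n}\heartsuit\cdots\heartsuit v_{k_1}$. *)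

(* Defs.v *)
From HB Require Import structures.
From mathcomp Require Import all_boot all_order all_algebra.
From mathcomp Require Import generic_quotient ring_quotient fraction zify.
From mathcomp Require Import all_classical all_reals.
From mathcomp Require Import complex.

Set Implicit Arguments.
Unset Strict Implicit.
Unset Printing Implicit Defensive.
Import Order.TTheory GRing.Theory Num.Theory.
Local Open Scope ring_scope.
Local Open Scope quotient_scope.
Local Open Scope complex_scope.

(* The field K = C(q), with C = R[i]. *)
Definition KK (R : realType) : fieldType := {fraction {poly R[i]}}.

Section Scalars.
Variable R : realType.
Implicit Types (p : {poly R[i]}) (a b : KK R).

Definition cst (c : R[i]) : KK R := tofrac (c%:P).
Definition q : KK R := tofrac ('X).

HB.instance Definition _ :=
  GRing.RMorphism.copy cst (@tofrac {poly R[i]} \o polyC).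

Definition at_qinv p : KK R := (map_poly cst p).[q^-1].

(* On fractions, bar is P/Q |-> P(q^-1)/Q(q^-1); by the lemmas below it is the
   C-linear field automorphism sending q to q^-1. *)
Definition bar a : KK R := at_qinv \n_(repr a) / at_qinv \d_(repr a).

Lemma q_neq0 : q != 0.
Proof. by rewrite tofrac_eq0 polyX_eq0. Qed.

Lemma at_qinvB p1 p2 : at_qinv (p1 - p2) = at_qinv p1 - at_qinv p2.
Proof. by rewrite /at_qinv rmorphB /= hornerD hornerN. Qed.

Lemma at_qinvD p1 p2 : at_qinv (p1 + p2) = at_qinv p1 + at_qinv p2.
Proof. by rewrite /at_qinv rmorphD /= hornerD. Qed.

Lemma at_qinvM p1 p2 : at_qinv (p1 * p2) = at_qinv p1 * at_qinv p2.
Proof. by rewrite /at_qinv rmorphM /= hornerM. Qed.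

Lemma at_qinv1 : at_qinv 1 = 1.
Proof. by rewrite /at_qinv rmorph1 hornerC. Qed.

Lemma at_qinv_eq0 p : (at_qinv p == 0) = (p == 0).
Proof.
apply/eqP/eqP => [|->]; last by rewrite /at_qinv rmorph0 horner0.
set m := (size p).
have : at_qinv p * q ^+ m =
  tofrac (\sum_(i < m) p`_i *: 'X^(m - i)).
  rewrite /at_qinv horner_poly mulr_suml rmorph_sum /=; apply: eq_bigr => i _.
  rewrite -mul_polyC rmorphM rmorphXn /= -/q -mulrA; congr (_ * _).
  rewrite -[X in q ^+ X](subnK (ltnW (ltn_ord i))) exprD mulrCA -exprMn.
  by rewrite mulVf ?q_neq0 // expr1n mulr1.
move=> + p0; rewrite p0 mul0r => /eqP; rewrite eq_sym tofrac_eq0 => /eqP s0.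
apply/polyP => j; rewrite coef0; case: (ltnP j m) => [jm|]; last first.
  by move=> mj; rewrite nth_default.
have := congr1 (fun r : {poly _} => r`_(m - j)) s0.
rewrite coef0 coef_sum (bigD1 (Ordinal jm)) //= coefZ coefXn eqxx mulr1.
rewrite big1 ?addr0 // => i ij; rewrite coefZ coefXn.
have -> : (m - j == m - i)%N = false; last by rewrite mulr0.
apply/eqP => e; move/eqP: ij; apply; apply: val_inj => /=.
by have := ltn_ord i; lia.
Qed.

Lemma frac_repr a : a = tofrac \n_(repr a) / tofrac \d_(repr a).
Proof.
have d0 := denom_ratioP (repr a).
apply: (mulIf (_ : tofrac \d_(repr a) != 0)); first by rewrite tofrac_eq0.
rewrite mulfVK ?tofrac_eq0 //.
have E r : tofrac r = \pi_{fraction {poly R[i]}} (Ratio r 1).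
  by unlock FracField.tofrac.
rewrite !E -[X in X * _]reprK -[LHS]FracField.pi_mul.
apply/eqmodP; rewrite /= FracField.equivfE /FracField.mulf.
by rewrite !numden_Ratio ?oner_neq0 ?mulr1 // mulrC.
Qed.

Lemma bar_frac p1 p2 : p2 != 0 ->
  bar (tofrac p1 / tofrac p2) = at_qinv p1 / at_qinv p2.
Proof.
move=> p20; have [a e] : exists a, a = tofrac p1 / tofrac p2 by eexists.
rewrite -e; move: e; rewrite [in X in X -> _](frac_repr a) /bar.
have d0 := denom_ratioP (repr a).
move/eqP; rewrite eqr_div ?tofrac_eq0 // -!rmorphM tofrac_eq => /eqP e.
by apply/eqP; rewrite eqr_div ?at_qinv_eq0 // -!at_qinvM e.
Qed.

Fact bar_is_zmod_morphism : zmod_morphism bar.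
Proof.
move=> a b; have d1 := denom_ratioP (repr a).
have d2 := denom_ratioP (repr b).
have -> : a - b = tofrac (\n_(repr a) * \d_(repr b) - \n_(repr b) * \d_(repr a))
                  / tofrac (\d_(repr a) * \d_(repr b)).
  rewrite [in LHS](frac_repr a) [in LHS](frac_repr b).
  by rewrite -mulNr addf_div ?tofrac_eq0 // mulNr -!rmorphM -rmorphB.
rewrite bar_frac ?mulf_neq0 // at_qinvB !at_qinvM /bar.
by rewrite -[in RHS]mulNr addf_div ?at_qinv_eq0 // mulNr.
Qed.

Fact bar_is_monoid_morphism : monoid_morphism bar.
Proof.
split=> [|a b]; first by rewrite -[1](divr1 1) -(rmorph1 (@tofrac _))
  bar_frac ?oner_neq0 // at_qinv1 divr1.
have d1 := denom_ratioP (repr a); have d2 := denom_ratioP (repr b).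
have -> : a * b = tofrac (\n_(repr a) * \n_(repr b))
                  / tofrac (\d_(repr a) * \d_(repr b)).
  rewrite [in LHS](frac_repr a) [in LHS](frac_repr b).
  by rewrite mulf_div -!rmorphM.
by rewrite bar_frac ?mulf_neq0 // !at_qinvM /bar mulf_div.
Qed.

HB.instance Definition _ :=
  GRing.isZmodMorphism.Build (KK R) (KK R) bar bar_is_zmod_morphism.
HB.instance Definition _ :=
  GRing.isMonoidMorphism.Build (KK R) (KK R) bar bar_is_monoid_morphism.

Lemma bar_tofrac p : bar (tofrac p) = at_qinv p.
Proof.
by rewrite -[tofrac p]divr1 -(rmorph1 (@tofrac _)) bar_frac ?oner_neq0 //
  at_qinv1 divr1.
Qed.

Lemma bar_cst c : bar (cst c) = cst c.
Proof. by rewrite bar_tofrac /at_qinv map_polyC hornerC. Qed.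

Lemma bar_q : bar q = q^-1.
Proof. by rewrite bar_tofrac /at_qinv map_polyX hornerX. Qed.

Lemma barK : involutive bar.
Proof.
move=> a; rewrite {2}(frac_repr a) {2}/bar rmorphM fmorphV.
have h p : bar (at_qinv p) = tofrac p.
  rewrite /at_qinv -horner_map -map_poly_comp.
  rewrite (eq_map_poly (bar_cst : bar \o cst =1 cst)).
  rewrite [X in _.[X]](_ : _ = q); last first.
    apply: etrans (fmorphV bar q) _; rewrite -[RHS]invrK.
    by congr (_^-1); exact: bar_q.
  rewrite (map_poly_comp (@tofrac _) polyC) horner_map; congr tofrac.
  exact: comp_polyXr.
by congr (_ / _); exact: h.
Qed.

End Scalars.

(* Boundary points of an n-diagram: inl i is the bottom vertex i and inr i the
   top vertex i, numbered from 0. *)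
Notation pt n := ('I_n + 'I_n)%type.

(* Position on the boundary circle of the strip: bottom line from left to right,
   then top line from right to left. *)
Definition pos n (x : pt n) : nat :=
  match x with inl i => i | inr i => n + (n - i.+1) end.

Definition is_diagram n (f : {ffun pt n -> pt n}) : bool :=
  [forall x, (f (f x) == x) && (f x != x)] &&
  [forall x, forall y,
    ~~ [&& pos x < pos y, pos y < pos (f x) & pos (f x) < pos (f y)]%N].

Record diagram n := Diagram {
  link :> {ffun pt n -> pt n};
  _ : is_diagram link }.

HB.instance Definition _ n := [isSub for @link n].
HB.instance Definition _ n := [Finite of diagram n by <:].

Definition id_link n : {ffun pt n -> pt n} :=
  [ffun x => match x with inl i => inr i | inr i => inl i end].

Fact id_linkP n : is_diagram (id_link n).
Proof.
apply/andP; split.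
  by apply/forallP => -[] i; rewrite !ffunE eqxx.
apply/forallP => -[] i; apply/forallP => -[] j; rewrite !ffunE /=;
  have := ltn_ord i; have := ltn_ord j; lia.
Qed.

Definition id_diag n := Diagram (id_linkP n).

(* For i : 'I_n.-1, the vertices i and i+1 (numbered from 0); the generator
   e_{i+1} of the algebra is indexed by i. *)
Definition lo n (i : 'I_n.-1) : 'I_n := widen_ord (leq_pred n) i.

Fact hi_subproof n (i : 'I_n.-1) : (i.+1 < n)%N.
Proof. by have := ltn_ord i; case: n i. Qed.

Definition hi n (i : 'I_n.-1) : 'I_n := Ordinal (hi_subproof i).

Definition e_link n (i : 'I_n.-1) : {ffun pt n -> pt n} :=
  [ffun x => match x with
    | inl j => if j == lo i then inl (hi i) else if j == hi i then inl (lo i)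
               else inr j
    | inr j => if j == lo i then inr (hi i) else if j == hi i then inr (lo i)
               else inl j
    end].

Local Lemma inl_inj (A B : Type) : injective (@inl A B).
Proof. by move=> x y []. Qed.

Local Lemma inr_inj (A B : Type) : injective (@inr A B).
Proof. by move=> x y []. Qed.

Fact e_linkP n (i : 'I_n.-1) : is_diagram (e_link i).
Proof.
have lh : lo i == hi i = false by apply/eqP => /(congr1 val) /=; lia.
have hl : hi i == lo i = false by rewrite eq_sym.
apply/andP; split.
  apply/forallP => -[] j; rewrite ffunE;
    (case: (eqVneq j (lo i)) => [->|jl]; last case: (eqVneq j (hi i)) => [->|jh]);
    rewrite ffunE ?eqxx ?lh ?hl ?(negPf jl) ?(negPf jh) /= ?(negPf jl) ?eqxx //=.
  - by rewrite (inj_eq (@inl_inj _ _)) hl.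
  - by rewrite (inj_eq (@inl_inj _ _)) lh.
  - by rewrite (inj_eq (@inr_inj _ _)) hl.
  - by rewrite (inj_eq (@inr_inj _ _)) lh.
apply/forallP => -[] j; apply/forallP => -[] l; rewrite !ffunE -!val_eqE /=;
  have := ltn_ord i; have := ltn_ord j; have := ltn_ord l;
  (repeat case: ifP) => /=; lia.
Qed.

Definition e_diag n (i : 'I_n.-1) := Diagram (e_linkP i).

(* Stacking D' on top of D: inl x is the boundary point x of D, inr x the
   boundary point x of D', and the top of D is glued to the bottom of D'. *)
Definition glued n (D' D : diagram n) : rel (pt n + pt n) := fun u v =>
  match u, v with
  | inl x, inl y => D x == y
  | inr x, inr y => D' x == y
  | inl (inr i), inr (inl j) => i == j
  | inr (inl i), inl (inr j) => i == j
  | _, _ => false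
  end.

Definition outer n (x : pt n) : pt n + pt n :=
  match x with inl i => inl (inl i) | inr i => inr (inr i) end.

Definition stacks n (D' D D'' : diagram n) : bool :=
  [forall x, connect (glued D' D) (outer x) (outer (D'' x))].

(* Components of the glued graph that meet no outer boundary point. *)
Definition loops n (D' D : diagram n) : nat :=
  n_comp (glued D' D)
    [pred u | [forall x, ~~ connect (glued D' D) (outer x) u]].

Section TemperleyLieb.
Variables (K : fieldType) (q : K) (n : nat).

Definition beta : K := - q - q^-1.

Definition TL : Type := {ffun diagram n -> K^o}.

HB.instance Definition _ := GRing.Lmodule.on TL.

Definition coefTL (x : TL) (D : diagram n) : K := x D.

Definition diagTL (D : diagram n) : TL := [ffun D' => (D' == D)%:R].

Definition oneTL : TL := diagTL (id_diag n).
Definition eTL (i : 'I_n.-1) : TL := diagTL (e_diag i).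

(* Bilinear extension of D' * D = beta ^ loops * D''. *)
Definition mulTL (x y : TL) : TL :=
  \sum_D' \sum_D (coefTL x D' * coefTL y D * beta ^+ loops D' D) *:
    (\sum_(D'' | stacks D' D D'') diagTL D'').

Definition TLmodule (M : lmodType K) (act : TL -> M -> M) : Prop :=
  [/\ forall x, linear (act x),
      forall m, linear (act^~ m),
      forall m, act oneTL m = m &
      forall x y m, act (mulTL x y) m = act x (act y m)].

(* triv_act k b c: b lies in the subalgebra generated by the e_i with i <> k,
   and acts on its one-dimensional module K_triv by the scalar c. *)
Inductive triv_act (k : nat) : TL -> K -> Prop :=
| triv_act_one : triv_act k oneTL 1
| triv_act_gen (i : 'I_n.-1) : i.+1 <> k -> triv_act k (eTL i) 0
| triv_act_lin a x y c d : triv_act k x c -> triv_act k y d ->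
    triv_act k (a *: x + y) (a * c + d)
| triv_act_mul x y c d : triv_act k x c -> triv_act k y d ->
    triv_act k (mulTL x y) (c * d).

(* Identifying TL (x)_K K_triv with TL, the subspace spanned by the elements
   (x * b) (x) 1 - x (x) (b . 1). *)
Inductive balanced (k : nat) : TL -> Prop :=
| balanced0 : balanced k 0
| balanced_lin a x y : balanced k x -> balanced k y -> balanced k (a *: x + y)
| balanced_rel x b c : triv_act k b c -> balanced k (mulTL x b - c *: x).

Definition bal (k : nat) : {pred TL} := fun x => `[< balanced k x >].

Fact bal_zmod_closed k : zmod_closed (bal k).
Proof.
split=> [|x y /asboolP hx /asboolP hy]; apply/asboolP; first exact: balanced0.
by rewrite addrC -scaleN1r; exact: balanced_lin.
Qed.

HB.instance Definition _ k := GRing.isZmodClosed.Build TL (bal k)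
  (bal_zmod_closed k).

Lemma balZ k a x : x \in bal k -> a *: x \in bal k.
Proof.
move=> /asboolP hx; apply/asboolP; rewrite -[_ *: _]addr0.
by apply: balanced_lin => //; exact: balanced0.
Qed.

(* The induced module TL_n (x)_(TL_k (x) TL_(n-k)) K_triv. *)
Definition Ind (k : nat) : Type := Quotient.quot (bal k).

HB.instance Definition _ k := GRing.Zmodule.on (Ind k).

Definition tens1 k (x : TL) : Ind k := \pi_(Quotient.quot (bal k)) x.

Definition Ind_scale k (a : K) (m : Ind k) : Ind k :=
  tens1 k (a *: (repr (m : Quotient.quot (bal k)))).

Lemma tens1K k (m : Ind k) : tens1 k (repr (m : Quotient.quot (bal k))) = m.
Proof. exact: reprK. Qed.

Lemma tens1D k : {morph tens1 k : x y / x + y}.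
Proof. by move=> x y; rewrite /tens1 !piE. Qed.

Lemma tens1_eq k x y : x - y \in bal k -> tens1 k x = tens1 k y.
Proof. by move=> h; apply/eqP; rewrite -Quotient.idealrBE. Qed.

Lemma tens1Z k a x : tens1 k (a *: x) = Ind_scale a (tens1 k x).
Proof.
apply: tens1_eq; rewrite -scalerBr; apply: balZ.
by rewrite Quotient.idealrBE reprK.
Qed.

Fact Ind_scaleA k a b (m : Ind k) :
  Ind_scale a (Ind_scale b m) = Ind_scale (a * b) m.
Proof. by rewrite -(tens1K m) -!tens1Z scalerA. Qed.

Fact Ind_scale1 k : left_id 1 (@Ind_scale k).
Proof. by move=> m; rewrite -(tens1K m) -!tens1Z scale1r. Qed.

Fact Ind_scaleDr k : right_distributive (@Ind_scale k) +%R.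
Proof.
move=> a m1 m2; rewrite -(tens1K m1) -(tens1K m2).
by rewrite -tens1D -!tens1Z scalerDr tens1D.
Qed.

Fact Ind_scaleDl k (m : Ind k) : {morph (@Ind_scale k)^~ m : a b / a + b}.
Proof.
by move=> a b; rewrite -(tens1K m) -!tens1Z scalerDl tens1D.
Qed.

HB.instance Definition _ k := GRing.Zmodule_isLmodule.Build K (Ind k)
  (@Ind_scaleA k) (@Ind_scale1 k) (@Ind_scaleDr k) (@Ind_scaleDl k).

Definition Ind_act k (x : TL) (m : Ind k) : Ind k :=
  tens1 k (mulTL x (repr (m : Quotient.quot (bal k)))).

(* Direct sum over 0 <= k <= n. *)
Definition IndSum : Type := {dffun forall k : 'I_n.+1, Ind k}.

HB.instance Definition _ := Choice.on IndSum.

Definition IndSum_of (f : forall k : 'I_n.+1, Ind k) : IndSum := finfun f.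

Definition comp (m : IndSum) (k : 'I_n.+1) : Ind k := m k.

Lemma comp_of f k : comp (IndSum_of f) k = f k.
Proof. exact: ffunE. Qed.

Lemma IndSum_eqP m1 m2 : (forall k, comp m1 k = comp m2 k) -> m1 = m2.
Proof. by move=> h; apply/ffunP. Qed.

Definition IndSum0 := IndSum_of (fun=> 0).
Definition IndSum_add m1 m2 := IndSum_of (fun k => comp m1 k + comp m2 k).
Definition IndSum_opp m := IndSum_of (fun k => - comp m k).
Definition IndSum_scale (a : K) m := IndSum_of (fun k => a *: comp m k).

Fact IndSum_addA : associative IndSum_add.
Proof. by move=> x y z; apply: IndSum_eqP => k; rewrite !comp_of addrA. Qed.
Fact IndSum_addC : commutative IndSum_add.
Proof. by move=> x y; apply: IndSum_eqP => k; rewrite !comp_of addrC. Qed.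
Fact IndSum_add0 : left_id IndSum0 IndSum_add.
Proof. by move=> x; apply: IndSum_eqP => k; rewrite !comp_of add0r. Qed.
Fact IndSum_addN : left_inverse IndSum0 IndSum_opp IndSum_add.
Proof. by move=> x; apply: IndSum_eqP => k; rewrite !comp_of addNr. Qed.

HB.instance Definition _ := GRing.isZmodule.Build IndSum
  IndSum_addA IndSum_addC IndSum_add0 IndSum_addN.

Fact IndSum_scaleA a b m :
  IndSum_scale a (IndSum_scale b m) = IndSum_scale (a * b) m.
Proof. by apply: IndSum_eqP => k; rewrite !comp_of scalerA. Qed.
Fact IndSum_scale1 : left_id 1 IndSum_scale.
Proof. by move=> m; apply: IndSum_eqP => k; rewrite !comp_of scale1r. Qed.
Fact IndSum_scaleDr : right_distributive IndSum_scale +%R.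
Proof. by move=> a x y; apply: IndSum_eqP => k; rewrite !comp_of scalerDr. Qed.
Fact IndSum_scaleDl m : {morph IndSum_scale^~ m : a b / a + b}.
Proof. by move=> a b; apply: IndSum_eqP => k; rewrite !comp_of scalerDl. Qed.

HB.instance Definition _ := GRing.Zmodule_isLmodule.Build K IndSum
  IndSum_scaleA IndSum_scale1 IndSum_scaleDr IndSum_scaleDl.

Definition IndSum_act (x : TL) (m : IndSum) : IndSum :=
  IndSum_of (fun k => Ind_act x (comp m k)).

(* No link joins two of the first k, or two of the last n - k, bottom vertices. *)
Definition Ind_diagram (k : nat) (D : diagram n) : Prop :=
  forall i j : 'I_n, D (inl i) = inl j ->
    ~ (i < k /\ j < k)%N /\ ~ (k <= i /\ k <= j)%N.

Definition diagrammatic_basis : set IndSum :=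
  [set m | exists (k : 'I_n.+1) (D : diagram n),
     [/\ Ind_diagram k D, comp m k = tens1 k (diagTL D) &
         forall k', k' <> k -> comp m k' = 0]].

End TemperleyLieb.

Section TensorPower.
Variables (K : fieldType) (q : K).

(* Sign sequences, listed from left to right; true stands for +. *)
Notation signs m := {ffun 'I_m -> bool}.

(* V, with coordinates in the basis v_+, v_-, and its m-th tensor power, with
   coordinates in the basis of the v_{s 0} (x) ... (x) v_{s (m-1)}. *)
Definition V : Type := {ffun bool -> K^o}.
HB.instance Definition _ := GRing.Lmodule.on V.

Definition tens (m : nat) : Type := {ffun signs m -> K^o}.
HB.instance Definition _ m := GRing.Lmodule.on (tens m).

Definition coord m (x : tens m) (s : signs m) : K := x s.

Definition vv (b : bool) : V := [ffun c => (c == b)%:R].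
Definition vtens m (s : signs m) : tens m := [ffun t => (t == s)%:R].

Definition K_V (v : V) : V := [ffun b => (if b then q else q^-1) * v b].
Definition E_V (v : V) : V := [ffun b => if b then v false else 0].
Definition F_V (v : V) : V := [ffun b => if b then 0 else v true].

(* A 0 (x) ... (x) A (m-1) *)
Definition tensop m (A : 'I_m -> V -> V) (x : tens m) : tens m :=
  \sum_t coord x t *: [ffun s : signs m => \prod_j (A j (vv (t j))) (s j)].

Definition F_tens m (x : tens m) : tens m :=
  \sum_(j < m) tensop
    (fun l => if (l < j)%N then id else if l == j then F_V else K_V) x.

Definition eps (a b : bool) : K :=
  match a, b with
  | true, false => - q
  | false, true => 1
  | _, _ => 0
  end.

Definition delta (a b : bool) : K :=
  match a, b with
  | true, false => 1
  | false, true => - q^-1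
  | _, _ => 0
  end.

(* id (x) (delta o eps) (x) id, with delta o eps in the factors lo i and hi i. *)
Definition e_tens m (i : 'I_m.-1) (x : tens m) : tens m :=
  \sum_t (coord x t * eps (t (lo i)) (t (hi i))) *:
    ([ffun s : signs m => delta (s (lo i)) (s (hi i)) *
      \prod_(j | (j != lo i) && (j != hi i)) (s j == t j)%:R] : tens m).

(* x (x) v *)
Definition tensr m (x : tens m) (v : V) : tens m.+1 :=
  [ffun s : signs m.+1 => x [ffun j => s (widen_ord (leqnSn m) j)] * v (s ord_max)].

(* The x_b such that x = x_+ (x) v_+ + x_- (x) v_-. *)
Definition lastcomp m (b : bool) (x : tens m.+1) : tens m :=
  [ffun s : signs m => x [ffun j => if unlift ord_max j is Some l then s l else b]].

Lemma tensr_lastcomp m (x : tens m.+1) :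
  x = \sum_b tensr (lastcomp b x) (vv b).
Proof.
apply/ffunP => s; rewrite sum_ffunE (bigD1 (s ord_max)) //= big1 => [|b].
  rewrite addr0 !ffunE eqxx mulr1; congr (x _); apply/ffunP => j; rewrite ffunE.
  case: unliftP => [l ->|->] //; rewrite ffunE; congr (s _).
  by apply: val_inj; rewrite /= /bump leqNgt ltn_ord.
by rewrite eq_sym => /negPf bs; rewrite !ffunE bs mulr0.
Qed.

Variable bar : {rmorphism K -> K}.

(* The bar involution; the recursion starts at V^{(x) 0} = K, where it is bar.
   Its defining properties are psi_antilinear, psi1 and psi_tensr below. *)
Fixpoint psi m : tens m -> tens m :=
  match m with
  | 0 => fun x => [ffun s => bar (x s)]
  | m'.+1 => fun x =>
      \sum_b (tensr (psi (lastcomp b x)) (vv b) +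
              (q - q^-1) *: tensr (F_tens (psi (lastcomp b x))) (E_V (vv b)))
  end.

Lemma tensrP m a x y (v : V) :
  @tensr m (a *: x + y) v = a *: tensr x v + tensr y v.
Proof. by apply/ffunP => s; rewrite !ffunE mulrDl scalerAl. Qed.

Lemma lastcompP m b a (x y : tens m.+1) :
  lastcomp b (a *: x + y) = a *: lastcomp b x + lastcomp b y.
Proof. by apply/ffunP => s; rewrite !ffunE. Qed.

Lemma F_tensP m a (x y : tens m) :
  F_tens (a *: x + y) = a *: F_tens x + F_tens y.
Proof.
rewrite /F_tens scaler_sumr -big_split; apply: eq_bigr => j _ /=.
rewrite /tensop scaler_sumr -big_split; apply: eq_bigr => t _ /=.
by rewrite /coord !ffunE scalerDl scalerA.
Qed.

Lemma lastcomp_tensr m (x : tens m) b c :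
  lastcomp c (tensr x (vv b)) = (b == c)%:R *: x.
Proof.
apply/ffunP => s; rewrite !ffunE unlift_none eq_sym [RHS]mulrC; congr (x _ * _).
apply/ffunP => j; rewrite !ffunE.
have -> : widen_ord (leqnSn m) j = lift ord_max j.
  by apply: val_inj; rewrite /= /bump leqNgt ltn_ord.
by rewrite liftK.
Qed.

Lemma psi_antilinear m a (x y : tens m) :
  psi (a *: x + y) = bar a *: psi x + psi y.
Proof.
elim: m x y => [|m IH] x y /=.
  by apply/ffunP => s; rewrite !ffunE rmorphD rmorphM.
rewrite scaler_sumr -big_split; apply: eq_bigr => b _ /=.
rewrite lastcompP IH F_tensP !tensrP !scalerDr !scalerA [_ * bar a]mulrC.
by rewrite -!addrA; congr (_ + _); rewrite addrCA.
Qed.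

Lemma psi_tensr m (x : tens m) b :
  psi (tensr x (vv b)) = tensr (psi x) (vv b) +
    (q - q^-1) *: tensr (F_tens (psi x)) (E_V (vv b)).
Proof.
have psiZ c : psi (c *: x) = bar c *: psi x.
  have p0 : @psi m 0 = 0.
    have := psi_antilinear 1 (0 : tens m) 0; rewrite rmorph1 !scale1r addr0.
    by move/(congr1 (fun z => z - psi 0)); rewrite addrK subrr.
  by have := psi_antilinear c x 0; rewrite p0 !addr0.
have F0 : @F_tens m 0 = 0.
  by rewrite -[0 in LHS](subrr 0) -scaleN1r addrC F_tensP scaleN1r addNr.
have t0 v : @tensr m 0 v = 0.
  by rewrite -[0 in LHS](subrr 0) -scaleN1r addrC tensrP scaleN1r addNr.
rewrite /= (bigD1 b) //= big1 => [|c]; rewrite lastcomp_tensr psiZ.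
  by rewrite eqxx rmorph1 scale1r addr0.
by rewrite eq_sym => /negPf ->; rewrite rmorph0 scale0r F0 !t0 scaler0 addr0.
Qed.

Lemma psi1 b : psi (vtens [ffun _ : 'I_1 => b]) = vtens [ffun=> b].
Proof.
have -> : vtens [ffun _ : 'I_1 => b] = tensr (vtens [ffun _ : 'I_0 => b]) (vv b).
  apply/ffunP => s; rewrite !ffunE.
  have -> : (s == [ffun=> b]) = (s ord_max == b).
    apply/eqP/eqP => [->|sb]; first by rewrite ffunE.
    by apply/ffunP => j; rewrite ffunE -sb (ord1 j) [in RHS](ord1 ord_max).
  have -> : [ffun j => s (widen_ord (leqnSn 0) j)] == [ffun=> b] :> {ffun 'I_0 -> bool}.
    by apply/eqP/ffunP => -[].
  by rewrite mul1r.
rewrite psi_tensr /F_tens big_ord0.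
have -> : tensr (0 : tens 0) (E_V (vv b)) = 0.
  by apply/ffunP => s; rewrite !ffunE mul0r.
rewrite scaler0 addr0; congr tensr.
apply/ffunP => s; rewrite !ffunE; apply: etrans (rmorph_nat bar _) _.
by [].
Qed.

(* q^-1 Z[q^-1] *)
Definition qinvZ (a : K) : Prop :=
  exists f : {poly int}, a = q^-1 * (map_poly intr f).[q^-1].

(* Sum of the n' rightmost signs; k_1, ..., k_n number the factors from right
   to left. *)
Definition rsum m (n' : nat) (s : signs m) : int :=
  \sum_(j < m | (m - n' <= j)%N) (if s j then 1 else -1).

Definition dominates m (l k : signs m) : Prop :=
  rsum m l = rsum m k /\
  forall n', (1 <= n' <= m)%N -> rsum n' k <= rsum n' l.

Definition is_heart m (k : signs m) (b : tens m) : Prop :=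
  psi b = b /\
  exists c : signs m -> K,
    [/\ forall l, qinvZ (c l),
        forall l, c l != 0 -> dominates l k &
        b - vtens k = \sum_l c l *: vtens l].

(* v_{k_n} heart ... heart v_{k_1} *)
Definition heart m (k : signs m) : tens m := xget 0 [set b | is_heart k b].

Definition dual_canonical_basis m : set (tens m) := range (@heart m).

End TensorPower.

Arguments eTL {K n} i.
Arguments IndSum_act {K} q {n} x m.
Arguments diagrammatic_basis {K} q n.
Arguments dual_canonical_basis {K} q bar m.

(* Main.v *)
From HB Require Import structures.
Require Import Defs.
From mathcomp Require Import all_classical all_reals complex.
From mathcomp Require Import all_boot all_order all_algebra.
From mathcomp Require Import generic_quotient ring_quotient fraction zify ring.

(* Bending the top line of a diagram down turns it into a noncrossing perfect
   matching of 2n points, and its operator on the tensor power into a product of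
   one weight per arc. Stacking two diagrams is then n contractions of a pair of
   adjacent points; each step keeps the matching noncrossing, multiplies the
   weights correctly (beta if a loop closes), and changes the components of the
   glued graph in a controlled way, so diagrams act multiplicatively. The matrix
   entries are triangular, an arc having its least weight at one orientation;
   hence the action is faithful and TL_n is associative.

   The step vector v_-^k (x) v_+^(n-k) is killed by the e_i with i <> k, so
   D (x) 1 |-> D (v_-^k (x) v_+^(n-k)) is well defined. For D in the diagrammatic
   basis the image is the product, over the caps of D, of
   v_+ (x) v_- - q^-1 v_- (x) v_+ and, over its through links, of the signs of
   the step vector. It is bar invariant, because inserting such a cap commutes
   with F and thus with psi, and it is unitriangular, so it is the dual canonical
   basis vector of its leading sign sequence. Read from the bottom point k on,
   around the boundary, these signs form a Dyck word, which is matched in exactly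
   one noncrossing way: this is the bijection between the two bases. *)

(** The dimension of the induced modules is not known in advance. A diagram [D] with a link between
    two bottom vertices on one side of [k] has an innermost such link at some [l, l+1], and
    [D e_l = beta D] gives [beta (D (x) 1) = 0]. As [beta] is nonzero in C(q), the diagrammatic
    basis spans. Its independence is read off the images: they are unitriangular and indexed by all
    sign sequences, so they are free and span the tensor power.

    The dual canonical basis is only characterized by its properties, so each of its vectors needs
    existence and uniqueness. The difference of two candidates is bar invariant and has coordinates
    in q^-1 Z[q^-1], and 0 is the only bar invariant scalar in that set. *)

Set Implicit Arguments.
Unset Strict Implicit.
Unset Printing Implicit Defensive.
Import Order.TTheory GRing.Theory Num.Theory.
Local Open Scope ring_scope.

(** * Noncrossing matchings *)

Section NoncrossingMatching.
Variables (T : finType) (p : T -> nat).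
Hypothesis p_inj : injective p.
Implicit Types (A : {set T}) (f g : T -> T) (x y z : T).
Local Open Scope nat_scope.

(** Stated relative to a set [A] of live points: gluing deletes points from [A] while the ambient
    type and the positions [p] stay fixed. *)
Record ncmatching A f : Prop := NCMatching {
  ncm_in : {in A, forall x, f x \in A};
  ncmK : {in A, forall x, f (f x) = x};
  ncm_neq : {in A, forall x, f x != x};
  ncm_nc : {in A &, forall x y, ~ (p x < p y < p (f x) /\ p (f x) < p (f y))} }.

Lemma ncm_pneq A f x : ncmatching A f -> x \in A -> p (f x) <> p x.
Proof. by move=> fA xA /p_inj /eqP; apply/negP; exact: (ncm_neq fA). Qed.

(** Otherwise the arc at [y] would leave the interval spanned by the arc at [x]; the instances of
    [ncm_nc] cover all orientations of the two arcs. *)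
Lemma ncm_between A f x y : ncmatching A f -> x \in A -> y \in A ->
  p x < p y < p (f x) -> p x < p (f y) < p (f x).
Proof.
move=> fA xA yA xy.
have := ncm_nc fA xA yA; have := ncm_nc fA yA (ncm_in fA xA).
have := ncm_nc fA (ncm_in fA yA) xA; have := ncm_nc fA (ncm_in fA yA) (ncm_in fA xA).
have := ncm_nc fA (ncm_in fA xA) (ncm_in fA yA).
have := ncm_nc fA (ncm_in fA xA) yA; have := ncm_nc fA xA (ncm_in fA yA).
rewrite !(ncmK fA) //.
have fy_fx : p (f y) <> p (f x).
  by move=> /p_inj /(congr1 f); rewrite !(ncmK fA) // => e; move: xy; rewrite e; lia.
have fy_x : p (f y) <> p x.
  by move=> /p_inj /(congr1 f); rewrite !(ncmK fA) // => e; move: xy; rewrite e; lia.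
by have := ncm_pneq fA yA; lia.
Qed.

(** Induction on the length of an arc from [x] to [f x]. The shorter arcs under it are shared, so
    [g] preserves the points under it. Hence [g x] lies at or beyond [f x], and [g (f x)] at or
    before [x]; if these were not equalities, the two arcs of [g] would cross. *)
Lemma ncm_unique A f g : ncmatching A f -> ncmatching A g ->
  {in A, forall x, (p x < p (f x)) = (p x < p (g x))} -> {in A, f =1 g}.
Proof.
move=> fA gA fg.
suff opener : {in A, forall x, p x < p (f x) -> g x = f x}.
  move=> x xA; case: (ltngtP (p x) (p (f x))) => [/opener->//|fx_x|/esym/(ncm_pneq fA xA)//].
  have fxA := ncm_in fA xA.
  have := opener _ fxA; rewrite (ncmK fA) // => /(_ fx_x) e.
  by rewrite -[in RHS]e (ncmK gA).
move=> x + ; have [d] := ubnP (p (f x) - p x).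
elim: d x => // d IH x dx xA lt_x; have fxA := ncm_in fA xA.
have gin : {in A, forall y, p x < p y < p (f x) -> p x < p (g y) < p (f x)}.
  move=> y yA xy; have := ncm_between fA xA yA xy => xfy.
  case: (ltngtP (p y) (p (f y))) => [yfy|fyy|/esym/(ncm_pneq fA yA)//].
    by rewrite IH //; lia.
  have := IH (f y); rewrite (ncmK fA) // => /(_ _ (ncm_in fA yA) fyy) => e.
  by rewrite -e ?(ncmK gA) ?(ncm_in fA) //; lia.
have gxA := ncm_in gA xA; have gfxA := ncm_in gA fxA.
have := lt_x; rewrite fg // => lt_gx.
have := fg _ fxA; rewrite (ncmK fA) // => fxE.
have h1 := gin _ gxA; rewrite (ncmK gA) // in h1.
have h2 := gin _ gfxA; rewrite (ncmK gA) // in h2.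
have n1 := ncm_pneq gA xA; have n2 := ncm_pneq gA fxA.
have c := ncm_nc gA gfxA xA; rewrite (ncmK gA) // in c.
apply: p_inj.
have e3 : p (g (f x)) <> p x -> p (g x) <> p (f x).
  by move=> + /p_inj /(congr1 g); rewrite (ncmK gA) // => + e; rewrite -e.
have e4 : p (g (f x)) = p x -> p (g x) = p (f x).
  by move=> /p_inj /(congr1 g); rewrite (ncmK gA) // => ->.
lia.
Qed.

(** Noncrossing as a parity: each side says whether a point lies between [x] and [f x]. This form is
    symmetric in the two ends of an arc, so no case split on orientations is needed when arcs are
    merged or the boundary is rotated. *)
Lemma ncm_sep A f x y : ncmatching A f -> x \in A -> y \in A ->
  y != x -> y != f x ->
  (p x < p y) (+) (p (f x) < p y) = (p x < p (f y)) (+) (p (f x) < p (f y)).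
Proof.
move=> fA xA yA /eqP yx /eqP yfx.
have xy_p : p y <> p x by move/p_inj.
have fxy_p : p y <> p (f x) by move/p_inj.
have n3 : p (f y) <> p x by move=> /p_inj e; apply: yfx; rewrite -e (ncmK fA).
have n4 : p (f y) <> p (f x).
  by move=> /p_inj /(congr1 f); rewrite !(ncmK fA).
have h1 := ncm_between fA xA yA.
have h2 := ncm_between fA (ncm_in fA xA) yA.
have h3 := ncm_between fA xA (ncm_in fA yA).
have h4 := ncm_between fA (ncm_in fA xA) (ncm_in fA yA).
rewrite !(ncmK fA) // in h2 h3 h4; lia.
Qed.

Lemma ncm_of_sep A f :
  {in A, forall x, f x \in A} -> {in A, forall x, f (f x) = x} ->
  {in A, forall x, f x != x} ->
  {in A &, forall x y, y != x -> y != f x ->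
    (p x < p y) (+) (p (f x) < p y) = (p x < p (f y)) (+) (p (f x) < p (f y))} ->
  ncmatching A f.
Proof.
move=> fin fK fneq sep; split=> // x y xA yA xy.
have yx : y != x by apply/eqP => e; move: xy; rewrite e; lia.
have yfx : y != f x by apply/eqP => e; move: xy; rewrite e; lia.
by have := sep x y xA yA yx yfx; lia.
Qed.

(** Identifying [a] with [b] merges their two arcs into one; if [a] and [b] are partners, a loop
    closes and the other arcs stay as they are. *)
Definition contract f a b : T -> T := fun x =>
  if f x == a then f b else if f x == b then f a else f x.

Lemma contract_ncm A f a b : ncmatching A f -> a \in A -> b \in A ->
  p a < p b -> {in A, forall x, ~~ (p a < p x < p b)} ->
  ncmatching (A :\ a :\ b) (contract f a b).
Proof.
move=> fA aA bA ab gap.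
have fa := ncmK fA aA; have fb := ncmK fA bA.
have ba' : (b == a) = false by apply/eqP => ba; rewrite ba ltnn in ab.
have faA := ncm_in fA aA; have fbA := ncm_in fA bA.
have fbaE : (f b == a) = (f a == b).
  by apply/eqP/eqP => <-; rewrite (ncmK fA).
have fxa x : x \in A -> f x = a -> x = f a by move=> xA <-; rewrite (ncmK fA).
have fxb x : x \in A -> f x = b -> x = f b by move=> xA <-; rewrite (ncmK fA).
have Lin x : x \in A :\ a :\ b -> [/\ x \in A, x != a & x != b].
  by rewrite !inE => /and3P[].
apply: ncm_of_sep.
- move=> x /Lin[xA xa xb]; rewrite !inE /contract.
  case: (eqVneq (f x) a) => [fx|fx].
    have xE := fxa _ xA fx; rewrite (ncm_neq fA) // fbA fbaE -xE xb /=.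
    by [].
  case: (eqVneq (f x) b) => [fxe|fx'].
    have xE := fxb _ xA fxe; rewrite (ncm_neq fA) // faA -fbaE -xE xa /=.
    by [].
  by rewrite fx fx' (ncm_in fA).
- move=> x /Lin[xA xa xb]; rewrite /contract.
  case: (eqVneq (f x) a) => [fx|fx].
    by rewrite fb ba' eqxx (fxa _ xA fx).
  case: (eqVneq (f x) b) => [fxe|fx'].
    by rewrite fa eqxx (fxb _ xA fxe).
  by rewrite (ncmK fA) // (negPf xa) (negPf xb).
- move=> x /Lin[xA xa xb]; rewrite /contract.
  case: (eqVneq (f x) a) => [fx|fx].
    rewrite (fxa _ xA fx); apply/eqP => /(congr1 f); rewrite !(ncmK fA) // => ba.
    by move: ab; rewrite ba ltnn.
  case: (eqVneq (f x) b) => [fxe|fx'].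
    rewrite (fxb _ xA fxe); apply/eqP => /(congr1 f); rewrite !(ncmK fA) // => ba.
    by move: ab; rewrite ba ltnn.
  exact: (ncm_neq fA).
have gapE z : z \in A -> z != a -> z != b ->
    (p a < p z) = (p b < p z) /\ (p z < p a) = (p z < p b).
  move=> zA /eqP za /eqP zb; have := gap _ zA.
  have za' : p z <> p a by move/p_inj.
  have zb' : p z <> p b by move/p_inj.
  lia.
have sepA z : z \in A -> z != a -> z != f a ->
    (p a < p z) (+) (p (f a) < p z) = (p a < p (f z)) (+) (p (f a) < p (f z)).
  by move=> zA za zfa; exact: (ncm_sep fA).
have sepB z : z \in A -> z != b -> z != f b ->
    (p b < p z) (+) (p (f b) < p z) = (p b < p (f z)) (+) (p (f b) < p (f z)).
  by move=> zA za zfa; exact: (ncm_sep fA).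
have neq z : z \in A :\ a :\ b -> f z != a -> f z != b -> z != f a /\ z != f b.
  move=> _ za zb; split; [apply: contra_neq za | apply: contra_neq zb] => ->.
    exact: fa.
  exact: fb.
(* The new arc [f a -- f b] separates what the arcs at [a] and at [b] separate
   together, because no point lies between [a] and [b]. *)
have main z : z \in A :\ a :\ b -> f z != a -> f z != b ->
    (p (f a) < p z) (+) (p (f b) < p z) =
    (p (f a) < p (f z)) (+) (p (f b) < p (f z)).
  move=> zA' za zb; have [zfa zfb] := neq _ zA' za zb.
  have [zA zna znb] := Lin _ zA'.
  have [+ _] := gapE _ zA zna znb; have [+ _] := gapE _ (ncm_in fA zA) za zb.
  have := sepA _ zA zna zfa; have := sepB _ zA znb zfb.
  move: (p (f b) < p z) (p (f a) < p z) (p (f b) < p (f z)) (p (f a) < p (f z)).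
  move: (p b < p z) (p a < p z) (p b < p (f z)) (p a < p (f z)).
  by do 8!case.
move=> x y xA' yA' yx; have [xA xa xb] := Lin _ xA'; have [yA ya yb] := Lin _ yA'.
rewrite /contract.
case: (eqVneq (f x) a) => [fx|fxa'].
  have xE := fxa _ xA fx; rewrite {fx}.
  case: (eqVneq (f y) a) => [/(fxa _ yA) e|fya].
    by move: yx; rewrite e xE eqxx.
  case: (eqVneq (f y) b) => [/(fxb _ yA) ->|fyb]; first by rewrite eqxx.
  by move=> _; rewrite xE main.
case: (eqVneq (f x) b) => [fx|fxb'].
  have xE := fxb _ xA fx; rewrite {fx}.
  case: (eqVneq (f y) a) => [/(fxa _ yA) ->|fya]; first by rewrite eqxx.
  case: (eqVneq (f y) b) => [/(fxb _ yA) e|fyb].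
    by move: yx; rewrite e xE eqxx.
  by move=> _; rewrite xE addbC main // addbC.
have [xfa xfb] := neq _ xA' fxa' fxb'.
have [_ gx] := gapE _ xA xa xb; have [_ gfx] := gapE _ (ncm_in fA xA) fxa' fxb'.
have := ncm_sep fA xA aA; have := ncm_sep fA xA bA.
rewrite ![_ == x]eq_sym xa xb ![_ == f x]eq_sym fxa' fxb' -gx -gfx.
move=> /(_ isT isT) sb /(_ isT isT) sa.
case: (eqVneq (f y) a) => [/(fxa _ yA) ->|fya] yfx; first by rewrite -sa -sb.
case: (eqVneq (f y) b) => [/(fxb _ yA) ->|fyb]; first by rewrite -sa -sb.
by apply: (ncm_sep fA) => //; rewrite eq_sym.
Qed.

(** * Weights of matchings under contraction *)

Section Weight.
Variables (K : fieldType) (q : K).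
Hypothesis q0 : (q != 0)%R.
Local Open Scope ring_scope.

(** These are the entries of [eps], while [gluew q u] is [delta q (~~ u) u]: gluing two points means
    inserting [delta] there. *)
Definition arcw (a b : bool) : K := (a != b)%:R * (if a then - q else 1).
Definition gluew (b : bool) : K := if b then - q^-1 else 1.

Definition openw f (l : T -> bool) x : K :=
  if (p x < p (f x))%N then arcw (l x) (l (f x)) else 1.
Definition matchw A f (l : T -> bool) : K := \prod_(x in A) openw f l x.

(** Only the arcs at [a] and [b] depend on [u]. Merging them is a zigzag identity between [eps] and
    [delta], and closing a loop evaluates [eps] on [delta]. *)
Lemma contract_weight A f a b (l : bool -> T -> bool) (l0 : T -> bool) :
  ncmatching A f -> a \in A -> b \in A -> (p a < p b)%N ->
  {in A, forall x, ~~ (p a < p x < p b)%N} ->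
  (forall u, l u a = ~~ u) -> (forall u, l u b = u) ->
  (forall u, {in A :\ a :\ b, l u =1 l0}) ->
  \sum_u gluew u * matchw A f (l u) =
    (- q - q^-1) ^+ (f a == b) * matchw (A :\ a :\ b) (contract f a b) l0.
Proof.
move=> fA aA bA ab gap la lb ll0.
have fa := ncmK fA aA; have fb := ncmK fA bA.
have ba : b != a by apply/eqP => e; rewrite e ltnn in ab.
have splitA u : matchw A f (l u) =
    openw f (l u) a * openw f (l u) b * \prod_(x in A :\ a :\ b) openw f (l u) x.
  by rewrite /matchw (big_setD1 a) //= (big_setD1 b) ?inE ?ba //= mulrA.
have [fab|fab] := eqVneq (f a) b.
  have {}fb : f b = a by rewrite -fab.
  have rest u : \prod_(x in A :\ a :\ b) openw f (l u) x =
      matchw (A :\ a :\ b) (contract f a b) l0.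
    apply: eq_bigr => x xA'; move: (xA'); rewrite !inE => /and3P[xb xa xA].
    have fxa : f x != a.
      by apply: contra_neq xb => /(congr1 f); rewrite (ncmK fA) // fab.
    have fxb : f x != b.
      by apply: contra_neq xa => /(congr1 f); rewrite (ncmK fA) // fb.
    rewrite /openw /contract (negPf fxa) (negPf fxb) ll0 // ll0 //.
    by rewrite !inE fxa fxb (ncm_in fA).
  under eq_bigr => u _ do rewrite splitA rest {1 2}/openw fab fb ab
    [(p b < p a)%N]ltnNge (ltnW ab) la lb mulr1 /= mulrA.
  (* The loop: [u = true] contributes [- q^-1] and [u = false] contributes [- q]. *)
  by rewrite -mulr_suml big_bool /arcw /gluew /=; congr (_ * _); ring.
have faA := ncm_in fA aA; have fbA := ncm_in fA bA.
set c := f a in fa fab faA *; set d := f b in fb fbA *.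
have ca : c != a := ncm_neq fA aA; have db : d != b := ncm_neq fA bA.
have da : d != a by apply: contra_neq fab; rewrite /c => <-.
have cd : c != d.
  by apply/eqP => e; move: ba; rewrite -fa e fb eqxx.
have cA' : c \in A :\ a :\ b by rewrite !inE fab ca.
have dA' : d \in A :\ a :\ b by rewrite !inE db da.
have splitA' f' l' : \prod_(x in A :\ a :\ b) openw f' l' x =
    openw f' l' c * openw f' l' d * \prod_(x in A :\ a :\ b :\ c :\ d) openw f' l' x.
  rewrite (big_setD1 c) //= (big_setD1 d) ?mulrA //.
  by rewrite in_setD1 dA' eq_sym cd.
have rest u : \prod_(x in A :\ a :\ b :\ c :\ d) openw f (l u) x =
    \prod_(x in A :\ a :\ b :\ c :\ d) openw (contract f a b) l0 x.
  apply: eq_bigr => x; rewrite in_setD1 => /andP[xd]; rewrite in_setD1 => /andP[xc xA'].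
  move: (xA'); rewrite !inE => /and3P[xb xa xA].
  have fxa : f x != a by apply: contra_neq xc => /(congr1 f); rewrite (ncmK fA).
  have fxb : f x != b by apply: contra_neq xd => /(congr1 f); rewrite (ncmK fA).
  rewrite /openw /contract (negPf fxa) (negPf fxb) ll0 // ll0 //.
  by rewrite !inE fxa fxb (ncm_in fA).
under eq_bigr => u _ do rewrite splitA splitA' rest mulrA mulrA.
rewrite -mulr_suml /matchw splitA' expr0 mul1r; congr (_ * _).
have fac : f a = c by []. have fbd : f b = d by [].
rewrite /openw /contract fac fbd fa fb eqxx (negPf ba) eqxx.
have P z t : z != t -> p z <> p t by move=> /eqP zt /p_inj.
have gapc := gap _ faA; have gapd := gap _ fbA.
have [pca pcb pda pdb pcd] := And5 (P _ _ ca) (P _ _ fab) (P _ _ da) (P _ _ db) (P _ _ cd).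
have nc1 := ncm_nc fA faA fbA; have nc2 := ncm_nc fA fbA aA.
have nc3 := ncm_nc fA aA bA; rewrite ?fa ?fb ?fac ?fbd in nc1 nc2 nc3.
rewrite big_bool !la !lb !ll0 //=.
have lt_false (z t : nat) : (z < t)%N -> (t < z)%N = false by case: ltngtP.
(* Since [a] and [b] are adjacent and the arcs do not cross, the partners are both to the left and
   nested, on opposite sides, or both to the right and nested. *)
have : [|| (p d < p c < p a)%N, (p c < p a)%N && (p b < p d)%N | (p b < p d < p c)%N].
  move: pca pcb pda pdb pcd nc1 nc2 nc3 ab gapc gapd.
  move: (p a) (p b) (p c) (p d); clear; lia.
case/or3P => /andP[h1 h2].
- have h3 := ltn_trans h1 (ltn_trans h2 ab).
  rewrite h1 h2 h3 (lt_false _ _ h1) (lt_false _ _ h2) (lt_false _ _ h3).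
  by case: (l0 c) (l0 d) => [] []; rewrite /arcw /gluew /=; field.
- have h3 := ltn_trans h1 (ltn_trans ab h2).
  rewrite h1 h2 h3 (lt_false _ _ h1) (lt_false _ _ h2) (lt_false _ _ h3).
  by case: (l0 c) (l0 d) => [] []; rewrite /arcw /gluew /=; field.
have h3 := ltn_trans ab (ltn_trans h1 h2).
rewrite h1 h2 h3 (lt_false _ _ h1) (lt_false _ _ h2) (lt_false _ _ h3).
by case: (l0 c) (l0 d) => [] []; rewrite /arcw /gluew /=; field.
Qed.

End Weight.

(** * Components of the glued graph *)

Section Components.
Implicit Types (e : rel T) (L : {set T}).

Definition glue e a b : rel T := fun u v =>
  [|| e u v, e u a && e b v | e u b && e a v].

(* The classes of [e] are the arcs of [f] on [A], extended by points outside
   [A], and the classes avoiding [A], each represented once in [L]. *)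
Record resolves e A f L : Prop := Resolves {
  res_refl : reflexive e;
  res_sym : symmetric e;
  res_trans : transitive e;
  res_arc : {in A &, forall x y, e x y = (y == x) || (y == f x)};
  res_cover : forall u, (exists2 x, x \in A & e u x) \/ (exists2 x, x \in L & e u x);
  res_disj : forall x y, x \in L -> y \in A -> ~~ e x y;
  res_uniq : {in L &, forall x y, e x y -> x = y} }.

(** If [f a = b], the class of [a] and [b] loses all its points in [A] and [a] becomes its
    representative in [L]; otherwise two arc classes merge, and [f a] represents them in the new
    [A]. *)
Lemma glue_resolves e A f L a b :
  ncmatching A f -> a \in A -> b \in A -> a != b -> resolves e A f L ->
  resolves (glue e a b) (A :\ a :\ b) (contract f a b)
    (if f a == b then a |: L else L).
Proof.
move=> fA aA bA ab [er es et arc cov disj uni].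
have fa := ncmK fA aA; have fb := ncmK fA bA.
have faA := ncm_in fA aA; have fbA := ncm_in fA bA.
have baN : (b == a) = false by rewrite eq_sym (negPf ab).
have eL x y : x \in L -> y \in A -> e x y = false.
  by move=> xL yA; apply: negbTE; exact: disj.
have eL' x y : x \in L -> y \in A -> e y x = false by move=> xL yA; rewrite es eL.
have sub u v : e u v -> glue e a b u v by rewrite /glue => ->.
have gs : symmetric (glue e a b).
  move=> u v; rewrite /glue es ![e _ b]es ![e _ a]es; congr (_ || _).
  by rewrite orbC andbC [X in _ || X]andbC.
have gt : transitive (glue e a b).
  move=> v u z; rewrite /glue.
  have euv := et v u z; have ezv := et v z u.
  case/or3P=> [uv|/andP[ua bv]|/andP[ub av]]; case/or3P=> [vz|/andP[va bz]|/andP[vb az]].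
  - by rewrite (et _ _ _ uv vz).
  - by rewrite (et _ _ _ uv va) bz !orbT.
  - by rewrite (et _ _ _ uv vb) az !orbT.
  - by rewrite ua (et _ _ _ bv vz) !orbT.
  - by rewrite ua bz !orbT.
  - by rewrite (et _ _ _ ua az).
  - by rewrite ub (et _ _ _ av vz) !orbT.
  - by rewrite (et _ _ _ ub bz).
  - by rewrite ub az !orbT.
have Lin x : x \in A :\ a :\ b -> [/\ x \in A, x != a & x != b].
  by rewrite !inE => /and3P[].
have gL x y : x \in L -> glue e a b x y = e x y.
  by move=> xL; rewrite /glue (eL x a) // (eL x b) // !orbF.
split=> //.
- by move=> u; rewrite /glue er.
- move=> x y /Lin[xA xa xb] /Lin[yA ya yb].
  rewrite /glue /contract !arc // [a == x]eq_sym [b == x]eq_sym (negPf xa) (negPf xb).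
  rewrite (negPf ya) (negPf yb) /=.
  case: (eqVneq (f x) a) => [fx|fxa].
    by rewrite fx (negPf ya) baN /= !orbF.
  case: (eqVneq (f x) b) => [fx|fxb].
    by rewrite fx (negPf yb) /= !orbF.
  by rewrite /= orbF.
- move=> u.
  case: (cov u) => [[x xA ux]|[x xL ux]]; last first.
    by right; exists x; [case: ifP => // _; rewrite !inE xL orbT|exact: sub].
  have uab : (x == a) || (x == b) -> glue e a b u a.
    by case/orP=> /eqP <-; rewrite /glue ux ?er ?andbT ?orbT.
  case xab: ((x == a) || (x == b)); last first.
    left; exists x; last exact: sub.
    by rewrite !inE xA andbT; move: xab; case: (x == a); case: (x == b).
  have {}uab := uab xab.
  case: (eqVneq (f a) b) => [fab|fab].
    by right; exists a => //; rewrite !inE eqxx.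
  left; exists (f a); first by rewrite !inE fab (ncm_neq fA).
  apply: gt uab _; apply: sub; rewrite arc ?eqxx ?orbT //.
- move=> x y; case: (eqVneq (f a) b) => [fab|fab].
    move=> + /Lin[yA ya yb]; rewrite in_setU1 => /orP[/eqP->|xL].
      rewrite /glue !arc // fab -[in f b]fab fa !eqxx (negPf ya) (negPf yb).
      by rewrite !andbF.
    by rewrite gL // eL.
  by move=> xL /Lin[yA ya yb]; rewrite gL // eL.
move=> x y; case: (eqVneq (f a) b) => [fab|fab]; last first.
  by move=> xL yL; rewrite gL //; exact: uni.
rewrite !in_setU1 => /orP[/eqP->|xL] /orP[/eqP->|yL] //.
- by rewrite gs gL // eL.
- by rewrite gL // eL.
by rewrite gL //; exact: uni.
Qed.

Lemma connect_glue e a b : symmetric e ->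
  connect (fun u v => [|| e u v, (u == a) && (v == b) | (u == b) && (v == a)])
    =2 glue (connect e) a b.
Proof.
move=> es; set r := (fun u v => _).
have sub : subrel (connect e) (connect r).
  by apply: connect_sub => u v uv; apply: connect1; rewrite /r uv.
have cs : symmetric (connect e) by exact: sym_connect_sym es.
have rab : connect r a b by apply: connect1; rewrite /r !eqxx orbT.
have rba : connect r b a by apply: connect1; rewrite /r !eqxx !orbT.
move=> u v; apply/idP/idP; last first.
  case/or3P=> [/sub//|/andP[/sub ua /sub bv]|/andP[/sub ub /sub av]].
    exact: connect_trans ua (connect_trans rab bv).
  exact: connect_trans ub (connect_trans rba av).
case/connectP => s; elim: s u => [|z s IH] u /=.
  by move=> _ ->; rewrite /glue connect0.
case/andP => uz /IH{}IH /IH; rewrite /glue.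
case/or3P: uz => [uz|/andP[/eqP-> /eqP->]|/andP[/eqP-> /eqP->]].
- have uzc := connect1 uz.
  case/or3P=> [h|/andP[h ->]|/andP[h ->]]; rewrite (connect_trans uzc h) ?orbT //.
- by case/or3P=> [->|/andP[_ ->]|/andP[_ ->]]; rewrite ?connect0 ?orbT.
by case/or3P=> [->|/andP[_ ->]|/andP[_ ->]]; rewrite ?connect0 ?orbT.
Qed.

End Components.

End NoncrossingMatching.

(** * Matching the letters of a Dyck word *)

Section DyckWord.
Local Open Scope nat_scope.

(** Stack algorithm: the fixed points of [f] are the openers still waiting for a partner. They lie
    under no arc, so a new closer can be joined to the last of them without crossing. The final
    count says how many are waiting. *)
Lemma dyck_prefix_matching (u : nat -> bool) N :
  (forall m, m <= N -> m <= (\sum_(x < m) u x).*2) ->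
  forall m, m <= N -> exists f : nat -> nat,
  [/\ forall x, x < m -> [/\ f x < m, f (f x) = x & u x = (x <= f x)],
      forall x y, x < m -> y < m -> ~ (x < y < f x /\ f x < f y),
      forall x y, x < m -> y < m -> x < y < f x -> f y <> y &
      (\sum_(x < m) u x).*2 = m + \sum_(x < m) (f x == x)].
Proof.
move=> uN; elim=> [_|m IH mN]; first by exists id; split=> //; rewrite !big_ord0.
have [f [fP fnc fund fcnt]] := IH (ltnW mN).
case um: (u m).
  exists (fun x => if x == m then m else f x); split.
  - move=> x; rewrite ltnS leq_eqVlt => /orP[/eqP->|xm]; first by rewrite !eqxx um !leqnn.
    have [h1 h2 h3] := fP _ xm.
    by rewrite (ltn_eqF xm) (ltn_eqF h1) h2 h3; split=> //; lia.
  - move=> x y xm ym; case: eqP => [->|nx]; first by lia.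
    have [h1 _ _] := fP x ltac:(lia).
    case: eqP => [->|ny]; first by lia.
    by apply: fnc; lia.
  - move=> x y xm ym; case: eqP => [->|nx]; first by lia.
    have [h1 _ _] := fP x ltac:(lia).
    case: eqP => [->|ny]; first by lia.
    by apply: fund; lia.
  rewrite !big_ord_recr /= um eqxx doubleD fcnt eqxx.
  under [in RHS]eq_bigr => x _ do rewrite ifN ?(ltn_eqF (ltn_ord x)) //.
  by rewrite addn2 addn1 addSn addnS.
(* Letter [m] is a closer, so the ballot condition for [m.+1] forces a waiting opener. *)
have := uN _ mN; rewrite big_ord_recr /= um addn0 fcnt => cnt.
have exP : exists x, (x < m) && (f x == x).
  have : 0 < \sum_(x < m) (f x == x) by lia.
  rewrite lt0n sum_nat_eq0 => /forallPn[x]; rewrite implyTb eqb0 negbK => fx.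
  by exists x; rewrite ltn_ord.
have exB x : (x < m) && (f x == x) -> x <= m by case/andP=> /ltnW.
(* The rightmost waiting opener, so that none remains under the new arc. *)
case: (ex_maxnP exP exB) => x0 /andP[x0m /eqP fx0] x0max.
have fix0 x : x < m -> f x = x -> x <= x0 by move=> xm fx; apply: x0max; rewrite xm fx eqxx.
have fne x : x < m -> x <> x0 -> f x <> x0.
  by move=> xm xx0 e; have [_ + _] := fP _ xm; rewrite e fx0 => /esym.
exists (fun x => if x == x0 then m else if x == m then x0 else f x); split.
- move=> x; rewrite ltnS => xm; case: (eqVneq x x0) => [->|/eqP xx0].
    have [_ _ h] := fP _ x0m; rewrite ltnSn eqxx h fx0 leqnn (ltnW x0m).
    by split=> //; case: eqP => // ->.
  case: (eqVneq x m) => [->|/eqP xm'].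
    by rewrite eqxx um (ltnW x0m : x0 < m.+1); split=> //; lia.
  have {}xm : x < m by lia.
  have [h1 h2 ->] := fP _ xm; have := fne _ xm xx0.
  by move=> /eqP /negPf ->; rewrite (ltn_eqF h1) h2; split=> //; lia.
- move=> x y xm ym.
  case: (eqVneq x x0) => [->|/eqP xx0].
    case: (eqVneq y x0) => [->|/eqP yx0]; first by lia.
    case: (eqVneq y m) => [->|/eqP ym']; first by lia.
    by have [h1 h2 _] := fP y ltac:(lia); lia.
  case: (eqVneq x m) => [->|/eqP xm']; first by lia.
  have xm2 : x < m by lia.
  have [h1 h2 _] := fP _ xm2.
  case: (eqVneq y x0) => [->|/eqP yx0].
    by have := fund x x0 xm2 x0m; rewrite fx0; lia.
  case: (eqVneq y m) => [->|/eqP ym']; first by lia.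
  by apply: fnc; lia.
- move=> x y xm ym.
  case: (eqVneq x x0) => [->|/eqP xx0].
    case: (eqVneq y x0) => [->|/eqP yx0]; first by lia.
    case: (eqVneq y m) => [->|/eqP ym']; first by lia.
    by move=> h e; have := fix0 y ltac:(lia) e; lia.
  case: (eqVneq x m) => [->|/eqP xm']; first by lia.
  have xm2 : x < m by lia.
  have [h1 h2 _] := fP _ xm2.
  case: (eqVneq y x0) => [->|/eqP yx0]; first by lia.
  case: (eqVneq y m) => [->|/eqP ym']; first by lia.
  by apply: fund; lia.
rewrite !big_ord_recr /= eqxx (gtn_eqF x0m) (ltn_eqF x0m) addn0.
rewrite (bigD1 (Ordinal x0m)) //= fx0 eqxx [in RHS](bigD1 (Ordinal x0m)) //= eqxx.
rewrite (gtn_eqF x0m) add0n add1n -addSnnS; congr (_ + _).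
apply: eq_bigr => x; rewrite -val_eqE /= => /negPf ->.
by rewrite (ltn_eqF (ltn_ord x)).
Qed.

Lemma dyck_matching (u : nat -> bool) N :
  (forall m, m <= N -> m <= (\sum_(x < m) u x).*2) ->
  (\sum_(x < N) u x).*2 = N ->
  exists f : nat -> nat,
  [/\ forall x, x < N -> [/\ f x < N, f (f x) = x & f x <> x],
      forall x, x < N -> u x = (x < f x) &
      forall x y, x < N -> y < N -> ~ (x < y < f x /\ f x < f y)].
Proof.
move=> uN uE; have [f [fP fnc _ fcnt]] := dyck_prefix_matching uN (leqnn N).
have nofix x : x < N -> f x <> x.
  move=> xN fx; have : \sum_(x < N) (f x == x) = 0 by lia.
  by move/eqP; rewrite sum_nat_eq0 => /forallP /(_ (Ordinal xN)) /=; rewrite fx eqxx.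
exists f; split=> // x xN; have [h1 h2 h3] := fP _ xN; have h4 := nofix _ xN => //.
by rewrite h3; lia.
Qed.

End DyckWord.

(** Column [i] involves, besides [c i], only coefficients of smaller rank. Used for the operators of
    diagrams and for the cap vectors. *)
Lemma triangular_free (K : fieldType) (I : finType) (rk : I -> nat) (B : I -> I -> K)
    (c : I -> K) :
  (forall i, B i i != 0) ->
  (forall i j, i != j -> B i j != 0 -> (rk i < rk j)%N) ->
  (forall j, \sum_i c i * B i j = 0) -> forall i, c i = 0.
Proof.
move=> B0 Brk cB; suff h m i : (rk i < m)%N -> c i = 0 by move=> i; exact: h (ltnSn _).
elim: m i => // m IH i; rewrite ltnS => im.
have := cB i; rewrite (bigD1 i) //= big1 ?addr0 => [/eqP|j ji].
  by rewrite mulf_eq0 (negPf (B0 i)) orbF => /eqP.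
have [->|Bji] := eqVneq (B j i) 0; first by rewrite mulr0.
by rewrite IH ?mul0r // (leq_trans (Brk _ _ ji Bji)).
Qed.

(** Exactly one end of each arc is labelled [true], and [s] always selects the end of smaller
    position. The sums are doubled so that an arc may be counted at both ends. This supplies the
    rank for both triangularity arguments. *)
Lemma opener_weight_min (T : finType) (p : T -> nat) (f : T -> T) (s t : T -> bool) :
  injective p -> involutive f ->
  (forall x, f x = x -> t x = s x) ->
  (forall x, f x <> x -> s x = (p x < p (f x))%N /\ t (f x) = ~~ t x) ->
  ~ (t =1 s) -> (\sum_x p x * s x < \sum_x p x * t x)%N.
Proof.
move=> p_inj fK fixed arc ts.
have pair (u : T -> bool) :
    ((\sum_x p x * u x).*2 = \sum_x (p x * u x + p (f x) * u (f x)))%N.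
  rewrite -addnn big_split /=; congr (_ + _)%N.
  by rewrite (reindex_inj (inv_inj fK)).
have le x : (p x * s x + p (f x) * s (f x) <= p x * t x + p (f x) * t (f x) ?=
    iff (t x == s x))%N.
  have [fx|/eqP fx] := eqVneq (f x) x.
    by rewrite fx fixed // eqxx; exact/leqif_refl.
  have [sx tfx] := arc _ fx; have pfx : p (f x) <> p x by move/p_inj.
  have [|sfx _] := arc (f x); first by rewrite fK => /esym.
  rewrite sx sfx fK tfx; split; case: (t x) => /=; rewrite ?muln0 ?muln1 ?addn0 ?add0n; lia.
rewrite -ltn_double !pair.
have := leqif_sum (fun x (_ : true) => le x); rewrite /= => h.
rewrite ltn_neqAle h h andbT; apply/negP => /forall_inP e; apply: ts => x.
exact/eqP/e.
Qed.

(** * Stacking diagrams *)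

Section Diagrams.
Variable n : nat.
Implicit Types (D : diagram n) (x y : pt n).

Lemma pos_lt (x : pt n) : (pos x < n + n)%N.
Proof. by case: x => i /=; have := ltn_ord i; lia. Qed.

Lemma pos_inj : injective (@pos n).
Proof.
move=> [i|i] [j|j] /= e; have := ltn_ord i; have := ltn_ord j; try lia;
  by move=> *; congr (_ _); apply: val_inj; move: e => /=; lia.
Qed.

Lemma diagram_ncm D : ncmatching (@pos n) [set: pt n] D.
Proof.
case: D => f /= /andP[/forallP f1 /forallP f2]; split=> x; rewrite ?inE //.
- by have /andP[/eqP] := f1 x.
- by have /andP[] := f1 x.
move=> y _ _; have /forallP /(_ y) := f2 x.
by move=> /and3P + [/andP[h1 h2] h3]; apply.
Qed.

Lemma ncm_is_diagram (f : {ffun pt n -> pt n}) :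
  ncmatching (@pos n) [set: pt n] f -> is_diagram f.
Proof.
case=> _ fK fneq fnc; apply/andP; split; apply/forallP => x.
  by rewrite fK ?fneq ?inE // eqxx.
apply/forallP => y; apply/negP => /and3P[h1 h2 h3].
by apply: (fnc x y); rewrite ?inE // h1 h2.
Qed.

Lemma diagramK D : involutive D.
Proof. by move=> x; rewrite (ncmK (diagram_ncm D)) ?inE. Qed.

Lemma diagram_neq D x : D x != x.
Proof. by rewrite (ncm_neq (diagram_ncm D)) ?inE. Qed.

Lemma diagram_eqP D D' : (forall x, (pos x < pos (D x))%N = (pos x < pos (D' x))%N) ->
  D = D'.
Proof.
move=> DD'; apply: val_inj; apply/ffunP => x.
by apply: (ncm_unique pos_inj (diagram_ncm D) (diagram_ncm D')); rewrite ?inE.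
Qed.

End Diagrams.

(** * Gluing two stacked diagrams vertex by vertex *)

Section Composition.
Variables (K : fieldType) (q : K) (n : nat).
Hypothesis q0 : q != 0.
Notation U := (pt n + pt n)%type.
Notation signs := {ffun 'I_n -> bool}.
Implicit Types (D : diagram n) (s t u : signs).

Definition ptlab s t (x : pt n) : bool :=
  match x with inl i => t i | inr i => ~~ s i end.

(* The entry at (v_s, v_t) of the operator of [D]: bending the top line down
   turns the label of a top point into its opposite, at the cost of [gluew]. *)
Definition diagmx D s t : K :=
  (\prod_i gluew q (s i)) * matchw (@pos n) q [set: pt n] D (ptlab s t).

(** The top of [D], read from right to left, is followed by the bottom of [D'], read from left to
    right. So the two copies of vertex 0 are adjacent, and once the vertices below [k] are glued and
    removed, so are the two copies of vertex [k]. *)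
Definition stackpos (x : U) : nat :=
  match x with inl x => pos x | inr x => (n + n + pos x)%N end.

Lemma stackpos_inj : injective stackpos.
Proof.
move=> [x|x] [y|y] /= e; have := pos_lt x; have := pos_lt y; try lia;
  by move=> *; congr (_ _); apply: pos_inj; lia.
Qed.

Variables D' D : diagram n.

Definition stacklink (x : U) : U :=
  match x with inl x => inl (D x) | inr x => inr (D' x) end.

Lemma stacklink_ncm : ncmatching stackpos [set: U] stacklink.
Proof.
have h := ncm_nc (diagram_ncm D); have h' := ncm_nc (diagram_ncm D').
split=> [//|[x|x] _|[x|x] _|[x|x] [y|y] _ _] /=; rewrite ?diagramK //.
- exact: diagram_neq.
- exact: diagram_neq.
- by apply: h; rewrite inE.
- by have := pos_lt (D x); lia.
- by have := pos_lt y; lia.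
by have := h' x y; rewrite !inE => /(_ isT isT); lia.
Qed.

Definition unglued (k : nat) : {set U} :=
  [set x : U | match x with
     | inl (inr i) => (k <= i)%N | inr (inl i) => (k <= i)%N | _ => true end].

Lemma glue_sites k (kn : (k < n)%N) :
  let a := inl (inr (Ordinal kn)) in let b := inr (inl (Ordinal kn)) in
  [/\ a \in unglued k, b \in unglued k, (stackpos a < stackpos b)%N,
      {in unglued k, forall x, ~~ (stackpos a < stackpos x < stackpos b)%N} &
      unglued k.+1 = unglued k :\ a :\ b].
Proof.
split; rewrite ?inE //=; first by lia.
  by move=> [[i|i]|[i|i]]; rewrite inE /=; have := ltn_ord i; lia.
apply/setP => x; rewrite !inE; case: x => [[i|i]|[i|i]] //=;
  by rewrite ltn_neqAle eq_sym andbC.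
Qed.

Definition partglued (k : nat) : rel U := fun x y =>
  match x, y with
  | inl x, inl y => D x == y
  | inr x, inr y => D' x == y
  | inl (inr i), inr (inl j) => (i == j) && (i < k)%N
  | inr (inl i), inl (inr j) => (i == j) && (i < k)%N
  | _, _ => false
  end.

Definition stacklab s t u (x : U) : bool :=
  match x with inl x => ptlab u t x | inr x => ptlab s u x end.

(** The state after [k] contractions with [c] loops closed. The labels of glued vertices have been
    summed out; pinning them to [false] keeps the index type the same at every stage. *)
Definition partsum s t k f c : K :=
  \sum_(u : signs | [forall i : 'I_n, (i < k)%N ==> ~~ u i])
    (\prod_(i < n | (k <= i)%N) gluew q (u i)) *
    ((- q - q^-1) ^+ c * matchw stackpos q (unglued k) f (stacklab s t u)).

Lemma partglued_sym k : symmetric (partglued k).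
Proof.
have sym (E : diagram n) x y : (E x == y) = (E y == x).
  by apply/eqP/eqP => <-; rewrite diagramK.
by move=> [[i|i]|[i|i]] [[j|j]|[j|j]] //=; rewrite ?(sym _ _ (inl _)) ?(sym _ _ (inr _)) //;
  rewrite eq_sym; case: eqP => // ->.
Qed.

Lemma partsum_step s t k (kn : (k < n)%N) (f : U -> U) c :
  let a := inl (inr (Ordinal kn)) in let b := inr (inl (Ordinal kn)) in
  ncmatching stackpos (unglued k) f ->
  partsum s t k f c =
    partsum s t k.+1 (contract f a b) (c + (f a == b)).
Proof.
set i0 := Ordinal kn => a b fA.
pose upd (u : signs) c : signs := [ffun i => if i == i0 then c else u i].
set P := fun k u => [forall i : 'I_n, (i < k)%N ==> ~~ u i].
set G := fun u => (\prod_(i < n | (k <= i)%N) gluew q (u i)) *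
    ((- q - q^-1) ^+ c * matchw stackpos q (unglued k) f (stacklab s t u)).
have PS (u : signs) : P k.+1 u = P k u && ~~ u i0.
  apply/forallP/andP => [h|[/forallP h hi0] i].
    split; last by have := h i0; rewrite /= ltnSn.
    by apply/forallP => i; apply/implyP => ik; have := h i; rewrite ltnS ltnW.
  apply/implyP; rewrite ltnS leq_eqVlt => /orP[/eqP ik|ik].
    by rewrite (_ : i = i0) //; apply: val_inj.
  by have := h i; rewrite ik.
have split_sum : \sum_(u | P k u) G u = \sum_(u | P k.+1 u) \sum_b G (upd u b).
  rewrite (bigID (fun u : signs => u i0)) /=.
  under [RHS]eq_bigr => u _ do rewrite big_bool /=.
  rewrite [RHS]big_split /=; congr (_ + _); last first.
    apply: eq_big => [u|u /andP[_ /negPf ui0]]; first by rewrite PS.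
    by congr G; apply/ffunP => i; rewrite ffunE; case: eqP => // ->.
  (* Turns the sequences with [u i0] true into those with [u i0] false, which index the sum for
     [k.+1]. *)
  pose flip (u : signs) : signs := [ffun i => (i == i0) (+) u i].
  have flipK : involutive flip.
    by move=> u; apply/ffunP => i; rewrite !ffunE addbA addbb.
  rewrite (reindex_inj (inv_inj flipK)) /=; apply: eq_big => [u|u /andP[_ ui0]].
    rewrite PS ffunE eqxx /=; congr (_ && _); apply: eq_forallb => i.
    by rewrite ffunE; case: eqP => // -> /=; rewrite ltnn.
  congr G; apply/ffunP => i; rewrite !ffunE; case: eqP => // ->.
  by move: ui0; rewrite ffunE eqxx.
rewrite [LHS]split_sum; apply: eq_bigr => u _.
have gl b' : \prod_(i < n | (k <= i)%N) gluew q (upd u b' i) =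
    gluew q b' * \prod_(i < n | (k.+1 <= i)%N) gluew q (u i).
  rewrite (bigD1 i0) //= ffunE eqxx; congr (_ * _).
  apply: eq_big => [i|i /andP[_ /negPf ii0]]; last by rewrite ffunE ii0.
  by rewrite -val_eqE /= ltn_neqAle eq_sym andbC.
have [aA bA ab gap ungluedS] := glue_sites kn.
under eq_bigr => b' _ do rewrite /G gl -mulrA mulrCA.
rewrite -mulr_sumr; congr (_ * _).
under eq_bigr => b' _ do rewrite mulrCA.
rewrite -mulr_sumr exprD -mulrA; congr (_ * _).
rewrite ungluedS -(contract_weight stackpos_inj q0 (l := fun b' => stacklab s t (upd u b'))) //=.
- by move=> b'; rewrite ffunE eqxx.
- by move=> b'; rewrite ffunE eqxx.
move=> b' x; rewrite !in_setD1 => /and3P[xb xa _].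
by case: x xa xb => [[i|i]|[i|i]] //= xa xb; rewrite ffunE ifN.
Qed.

(** Matching, components and weights are carried through one induction, so that the exponent of the
    loop value is the number of components in [L] at every stage. *)
Lemma partglued_resolves k : (k <= n)%N ->
  exists (f : U -> U) (L : {set U}),
    [/\ ncmatching stackpos (unglued k) f,
        resolves (connect (partglued k)) (unglued k) f L &
        forall s t, partsum s t 0 stacklink 0 = partsum s t k f #|L|].
Proof.
elim: k => [_|k IH kn].
  have u0 : unglued 0 = [set: U] by apply/setP => -[[i|i]|[i|i]]; rewrite !inE.
  exists stacklink, set0; rewrite u0; split.
  - exact: stacklink_ncm.
  - have c0 x y : connect (partglued 0) x y = (y == x) || (y == stacklink x).
      apply/idP/idP => [|/orP[/eqP->|/eqP->]]; first last.
      + by apply: connect1; case: (x) => -[z|z]; rewrite /= eqxx.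
      + exact: connect0.
      have step z w : partglued 0 z w -> w = stacklink z.
        by case: z w => [[i|i]|[i|i]] [[j|j]|[j|j]] //=; rewrite ?andbF // => /eqP ->.
      case/connectP => p; elim: p x => [|z p IHp] x /=; first by move=> _ ->; rewrite eqxx.
      case/andP => /step -> /IHp {}IHp /IHp.
      by rewrite (ncmK stacklink_ncm) ?inE // orbC.
    split.
    + exact: connect0.
    + by move=> x y; rewrite (sym_connect_sym (@partglued_sym 0)).
    + by move=> y x z; exact: connect_trans.
    + by move=> x y _ _; rewrite c0.
    + by move=> x; left; exists x; rewrite ?inE.
    + by move=> x y; rewrite inE.
    + by move=> x y; rewrite inE.
  - by move=> s t; rewrite cards0.
have [f [L [fA res sumE]]] := IH (ltnW kn).
set a : U := inl (inr (Ordinal kn)); set b : U := inr (inl (Ordinal kn)).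
have [aA bA ab gap ungluedS] := glue_sites kn.
exists (contract f a b), (if f a == b then a |: L else L); rewrite ungluedS; split.
- exact: (contract_ncm stackpos_inj).
- have := glue_resolves fA aA bA isT res.
  case=> h1 h2 h3 h4 h5 h6 h7.
  have cE : connect (partglued k.+1) =2 glue (connect (partglued k)) a b.
    move=> x y; rewrite -(connect_glue _ _ (@partglued_sym k)); apply: eq_connect => {x y}.
    have E (i j : 'I_n) : (i == j) && (i < k.+1)%N =
        (i == j) && (i < k)%N || (i == Ordinal kn) && (j == Ordinal kn).
      have [->|ij] := eqVneq i j; first by rewrite ltnS leq_eqVlt orbC andbb -val_eqE.
      have [ei|//] := eqVneq i (Ordinal kn); have [ej|//] := eqVneq j (Ordinal kn).
      by rewrite ei ej eqxx in ij.
    by move=> [[i|i]|[i|i]] [[j|j]|[j|j]] //=; rewrite ?orbF ?andbF //= orbF.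
  split.
  + by move=> x; rewrite cE.
  + by move=> x y; rewrite !cE.
  + by move=> y x z; rewrite !cE; exact: h3.
  + by move=> x y xA yA; rewrite cE h4.
  + by move=> x; case: (h5 x) => -[y yA xy]; [left|right]; exists y; rewrite ?cE.
  + by move=> x y xL yA; rewrite cE h6.
  + by move=> x y xL yL; rewrite cE; exact: h7.
move=> s t; rewrite sumE (partsum_step _ _ kn) //; congr partsum.
case: ifP => _; last by rewrite addn0.
rewrite cardsU1 addnC; congr (_ + _)%N.
by rewrite (_ : a \notin L) //; apply/negP => aL; have := res_disj res aL aA; rewrite connect0.
Qed.

End Composition.

Section Composite.
Variables (K : fieldType) (q : K) (n : nat).
Hypothesis q0 : q != 0.
Notation U := (pt n + pt n)%type.
Notation signs := {ffun 'I_n -> bool}.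
Implicit Types (s t u : signs).
Variables D' D : diagram n.

Lemma outer_inj : injective (@outer n).
Proof. by move=> [i|i] [j|j] //= []->. Qed.

Lemma ungluedP (x : U) : reflect (exists y, x = outer y) (x \in unglued n n).
Proof.
apply: (iffP idP) => [|[[i|i] ->]]; rewrite ?inE //.
case: x => [[i|i]|[i|i]]; rewrite ?[(n <= i)%N]leqNgt ?ltn_ord // => _.
  by exists (inl i).
by exists (inr i).
Qed.

Lemma glued_partglued : glued D' D =2 partglued D' D n.
Proof. by move=> [[i|i]|[i|i]] [[j|j]|[j|j]] //=; rewrite ltn_ord andbT. Qed.

Definition uncut (x : U) : pt n := match x with inl x => x | inr x => x end.

(** [mulTL] sums over all diagrams related to the stack; the first clause shows that there is
    exactly one, so the second is multiplicativity of [diagmx]. *)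
Lemma composite : exists D0 : diagram n,
  (forall D'', stacks D' D D'' = (D'' == D0)) /\
  (forall s t, \sum_u diagmx q D' s u * diagmx q D u t =
     beta q ^+ loops D' D * diagmx q D0 s t).
Proof.
have [f [L [fA res sumE]]] := partglued_resolves q0 D' D (leqnn n).
have cE : connect (glued D' D) =2 connect (partglued D' D n).
  exact: eq_connect glued_partglued.
pose f0 := [ffun x : pt n => uncut (f (outer x))].
have outA x : outer x \in unglued n n by apply/ungluedP; exists x.
have f0E x : outer (f0 x) = f (outer x).
  rewrite ffunE; have /ungluedP[y ->] := ncm_in fA (outA x).
  by case: y => i.
have outer_lt (x y : pt n) : (stackpos (outer x) < stackpos (outer y))%N = (pos x < pos y)%N.
  by move: x y => [i|i] [j|j] /=; have := ltn_ord i; have := ltn_ord j; lia.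
have f0A : ncmatching (@pos n) [set: pt n] f0.
  split=> [x _|x _|x _|x y _ _]; first by rewrite inE.
  - by apply: outer_inj; rewrite !f0E (ncmK fA).
  - by rewrite -(inj_eq outer_inj) f0E (ncm_neq fA).
  - have := ncm_nc fA (outA x) (outA y).
    by rewrite -!f0E !outer_lt.
exists (Diagram (ncm_is_diagram f0A)); split=> [D''|s t].
  apply/forallP/eqP => [h|-> x]; last first.
    by rewrite cE (res_arc res) //= f0E eqxx orbT.
  apply: val_inj; apply/ffunP => x; have := h x.
  rewrite cE (res_arc res) // (inj_eq outer_inj) (negPf (diagram_neq _ _)) /=.
  by move=> /eqP; rewrite -f0E => /outer_inj.
have loopsE : loops D' D = #|L|.
  have cs : connect_sym (partglued D' D n) := sym_connect_sym (@partglued_sym _ D' D n).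
  have csg : connect_sym (glued D' D) by move=> x y; rewrite !cE cs.
  rewrite /loops /n_comp_mem.
  (* [L] meets each component away from the boundary exactly once, whereas [n_comp] counts canonical
     roots. *)
  transitivity #|[set fingraph.root (glued D' D) x | x in L]|.
    apply: eq_card => x; rewrite !inE /=; apply/andP/imsetP.
      case=> /eqP xr /forallP xo; case: (res_cover res x) => -[y yA xy].
        have /ungluedP[z yz] := yA; have := xo z.
        by rewrite -yz csg cE xy.
      exists y => //; rewrite -[LHS]xr; apply/eqP; rewrite (root_connect csg) cE //.
    case=> y yL ->; split; first exact: roots_root.
    apply/forallP => z; apply/negP => h.
    have := res_disj res yL (outA z); rewrite -cE csg.
    by rewrite (connect_trans h) // csg connect_root.
  rewrite card_in_imset // => x y xL yL /eqP; rewrite (root_connect csg) cE.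
  exact: (res_uniq res).
transitivity ((\prod_i gluew q (s i)) * partsum q s t 0 (stacklink D' D) 0).
  rewrite mulr_sumr /partsum; apply: eq_big => [u|u _].
    by apply/esym/forallP => i.
  rewrite expr0 mul1r /diagmx mulrACA -mulrA; congr (_ * (_ * _)).
  have -> : unglued n 0 = [set: U] by apply/setP => -[[i|i]|[i|i]]; rewrite !inE.
  rewrite /matchw [RHS](eq_bigl xpredT); last by move=> x; rewrite inE.
  rewrite [RHS]big_sumType [RHS]mulrC /=; congr (_ * _).
    by apply: eq_big => [x|x _]; rewrite ?inE // /openw /= ltn_add2l.
  by apply: eq_big => [x|x _]; rewrite ?inE.
rewrite sumE loopsE mulrCA; congr (_ * _).
rewrite /partsum (big_pred1 [ffun=> false]); last first.
  move=> u; apply/forallP/eqP => [h|-> i]; last by rewrite ffunE implybT.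
  by apply/ffunP => i; rewrite ffunE; have := h i; rewrite ltn_ord /= => /negPf.
rewrite big1 ?mul1r => [|i]; last by rewrite leqNgt ltn_ord.
congr (_ * _).
transitivity (\prod_(x : U | x \in [set outer y | y in [set: pt n]])
    openw (@stackpos n) q f (stacklab s t [ffun=> false]) x).
  apply: eq_bigl => x; apply/ungluedP/imsetP => [[y ->]|[y _ ->]]; by exists y.
rewrite big_imset /=; last by move=> x y _ _; exact: outer_inj.
apply: eq_bigr => x _; rewrite /openw /= -f0E outer_lt.
have labE y : stacklab s t [ffun=> false] (outer y) = ptlab s t y by case: y.
by rewrite !labE.
Qed.

End Composite.

(** * The action on the tensor power *)

Lemma matchw_neq0 (T : finType) (p : T -> nat) (K : fieldType) (q : K) (f : T -> T)
    (l : T -> bool) :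
  injective p -> ncmatching p [set: T] f -> q != 0 ->
  (matchw p q [set: T] f l != 0) = [forall x, l (f x) == ~~ l x].
Proof.
move=> p_inj fT q0; apply/prodf_neq0/forallP => [h x|h x _]; last first.
  rewrite /openw /arcw (eqP (h x)); case: ifP => _; last exact: oner_neq0.
  by rewrite mulf_neq0 //; case: (l x); rewrite /= ?oner_neq0 ?oppr_eq0.
have key y : (p y < p (f y))%N -> l (f y) == ~~ l y.
  move=> lt; have := h y (in_setT y); rewrite /openw lt /arcw.
  by case: (l y) (l (f y)) => [] [] //; rewrite mul0r eqxx.
have := ncm_pneq p_inj fT (in_setT x).
case: (ltngtP (p x) (p (f x))) => [lt _|lt _|-> //]; first exact: key.
have := key (f x); rewrite (ncmK fT) ?inE // => /(_ lt) /eqP ->.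
by rewrite negbK.
Qed.

Section Operators.
Variables (K : fieldType) (q : K) (n : nat).
Hypothesis q0 : q != 0.
Notation signs := {ffun 'I_n -> bool}.
Notation TL := (TL K n).
Implicit Types (s t u : signs) (x y : TL) (D : diagram n).

Definition opmx s t x : K := \sum_D x D * diagmx q D s t.

Fact opmx_linear s t : linear (opmx s t : TL -> K^o).
Proof.
move=> a x y; rewrite /opmx scaler_sumr -big_split; apply: eq_bigr => D _ /=.
by rewrite !ffunE mulrDl scalerAl.
Qed.

HB.instance Definition _ s t :=
  GRing.isLinear.Build K TL K^o *:%R (opmx s t : TL -> K^o) (opmx_linear s t).

Lemma opmx_diag s t D : opmx s t (diagTL K D) = diagmx q D s t.
Proof.
rewrite /opmx (bigD1 D) //= ffunE eqxx mul1r big1 ?addr0 // => D1 /negPf DD1.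
by rewrite ffunE DD1 mul0r.
Qed.

Lemma opmx_mul s t x y : opmx s t (mulTL q x y) = \sum_u opmx s u x * opmx u t y.
Proof.
rewrite /mulTL linear_sum /=.
under eq_bigr => D' _ do rewrite linear_sum /=.
under [RHS]eq_bigr => u _ do rewrite /opmx big_distrlr /=.
rewrite [RHS]exchange_big /=; apply: eq_bigr => D' _.
rewrite [RHS]exchange_big /=; apply: eq_bigr => D _.
have [D0 [st val0]] := composite q0 D' D.
rewrite linearZ /= (eq_bigl _ _ st) big_pred1_eq opmx_diag.
under [RHS]eq_bigr => u _ do rewrite mulrACA.
by rewrite -mulr_sumr val0 /coefTL -[LHS]mulrA.
Qed.

Definition opener D (z : pt n) : bool := (pos z < pos (D z))%N.

(** Each diagram is tested at the entry whose labels mark the sources of its arcs. If [D1] is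
    nonzero at the test of [D2], those labels alternate along the arcs of [D1], so
    [opener_weight_min] ranks [D1] below [D2] unless they agree. *)
Lemma opmx_inj x y : (forall s t, opmx s t x = opmx s t y) -> x = y.
Proof.
move=> xy; apply/eqP; rewrite -subr_eq0; apply/eqP/ffunP => D; rewrite [RHS]ffunE.
pose src D : signs := [ffun i => opener D (inl i)].
pose tgt D : signs := [ffun i => ~~ opener D (inr i)].
have labE D1 : ptlab (tgt D1) (src D1) =1 opener D1.
  by case=> i; rewrite /= ffunE ?negbK.
pose B D' D := diagmx q D' (tgt D) (src D).
have B0 D1 D2 : B D1 D2 != 0 -> forall z, opener D2 (D1 z) = ~~ opener D2 z.
  rewrite /B /diagmx mulf_eq0 negb_or => /andP[_].
  rewrite (matchw_neq0 _ (@pos_inj n) (diagram_ncm D1) q0) => /forallP h z.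
  by have /eqP := h z; rewrite !labE.
move: D; apply: (@triangular_free _ _ (fun D => \sum_z pos z * opener D z)%N B).
- move=> D; rewrite mulf_neq0 //.
    by apply/prodf_neq0 => i _; rewrite /gluew; case: ifP; rewrite ?oner_neq0 // oppr_eq0 invr_eq0.
  rewrite (matchw_neq0 _ (@pos_inj n) (diagram_ncm D) q0); apply/forallP => z.
  rewrite !labE /opener diagramK; have := ncm_pneq (@pos_inj n) (diagram_ncm D) (in_setT z).
  by case: ltngtP.
- move=> D1 D2 D12 /B0 h; apply: opener_weight_min (@pos_inj n) (@diagramK _ D1) _ _ _.
  + by move=> z /eqP; rewrite (negPf (diagram_neq _ _)).
  + by move=> z _; split=> //; exact: h.
  + by move=> e; apply/negP: D12; rewrite negbK; apply/eqP; apply: diagram_eqP => z; exact/esym/e.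
move=> D; have := xy (tgt D) (src D) => /eqP.
by rewrite -subr_eq0 -linearB => /eqP.
Qed.

Lemma mulTL_linearr x : linear (mulTL q x).
Proof.
move=> a y z; apply: opmx_inj => s t; rewrite linearP /= !opmx_mul.
rewrite scaler_sumr -big_split; apply: eq_bigr => u _ /=.
by rewrite linearP mulrDr scalerAr.
Qed.

Lemma mulTL_linearl y : linear (fun x => mulTL q x y).
Proof.
move=> a x z; apply: opmx_inj => s t; rewrite linearP /= !opmx_mul.
rewrite scaler_sumr -big_split; apply: eq_bigr => u _ /=.
by rewrite linearP mulrDl scalerAl.
Qed.

Lemma mulTLA x y z : mulTL q (mulTL q x y) z = mulTL q x (mulTL q y z).
Proof.
apply: opmx_inj => s t; rewrite !opmx_mul.
under eq_bigr => u _ do rewrite opmx_mul mulr_suml.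
under [RHS]eq_bigr => u _ do rewrite opmx_mul mulr_sumr.
rewrite exchange_big /=; apply: eq_bigr => u _; apply: eq_bigr => v _.
by rewrite mulrA.
Qed.

Lemma diagmx_split D s t :
  diagmx q D s t = (\prod_i gluew q (s i)) *
    ((\prod_i openw (@pos n) q D (ptlab s t) (inl i)) *
     (\prod_i openw (@pos n) q D (ptlab s t) (inr i))).
Proof.
rewrite /diagmx /matchw big_sumType /=; congr (_ * (_ * _));
  by apply: eq_bigl => i; rewrite inE.
Qed.

(** For a vertical link [gluew q b * arcw q b (~~ b) = 1]: the factor [gluew] undoes the bending. *)
Lemma opmx_one s t : opmx s t (oneTL K n) = (s == t)%:R.
Proof.
rewrite opmx_diag diagmx_split [X in _ * (_ * X)]big1 ?mulr1 => [|i _]; last first.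
  by rewrite /openw /= ffunE /= ltnNge ltnW // (leq_trans (ltn_ord i)) // leq_addr.
rewrite -big_split /= (eq_bigr (fun i => (s i == t i)%:R)) => [|i _].
  have [->|st] := eqVneq s t; first by rewrite big1 // => i _; rewrite eqxx.
  have /existsP[i si] : [exists i, s i != t i].
    rewrite -negb_forall; apply: contra st => /forallP h.
    by apply/eqP/ffunP => i; exact/eqP.
  by rewrite (bigD1 i) //= (negPf si) mul0r.
rewrite /openw /= ffunE /= ifT ?(leq_trans (ltn_ord i)) ?leq_addr //.
by case: (s i) (t i) => [] []; rewrite /arcw /gluew /= ?mulr0 ?mul0r ?mulr1 //; field.
Qed.

Lemma opmx_e s t (i : 'I_n.-1) : opmx s t (eTL i) =
  eps q (t (lo i)) (t (hi i)) * (delta q (s (lo i)) (s (hi i)) *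
    \prod_(j | (j != lo i) && (j != hi i)) (s j == t j)%:R).
Proof.
have hl : hi i != lo i by apply/eqP => /(congr1 val) /=; lia.
have lh : lo i != hi i by rewrite eq_sym.
have split3 (F : 'I_n -> K) : \prod_j F j =
    F (lo i) * (F (hi i) * \prod_(j | (j != lo i) && (j != hi i)) F j).
  by rewrite (bigD1 (lo i)) //= (bigD1 (hi i)).
rewrite opmx_diag diagmx_split !split3.
have hn := ltn_ord i; have hn' : (i.+1 < n)%N by lia.
rewrite [X in _ * (_ * (_ * (_ * X)))]big1 ?mulr1 => [|j /andP[jl jh]]; last first.
  rewrite /openw /= ffunE (negPf jl) (negPf jh) /=; case: ifP => //.
  by have := ltn_ord j; lia.
rewrite [X in _ = _ * (_ * X)](_ : _ =
  (\prod_(j | (j != lo i) && (j != hi i)) gluew q (s j)) *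
   (\prod_(j | (j != lo i) && (j != hi i))
      openw (@pos n) q (e_diag i) (ptlab s t) (inl j))); last first.
  rewrite -big_split /=; apply: eq_bigr => j /andP[jl jh].
  rewrite /openw /= ffunE (negPf jl) (negPf jh) /= ifT; last by have := ltn_ord j; lia.
  by case: (s j) (t j) => [] []; rewrite /arcw /gluew /= ?mulr0 ?mul0r ?mulr1 //; field.
have -> : openw (@pos n) q (e_diag i) (ptlab s t) (inl (lo i)) = eps q (t (lo i)) (t (hi i)).
  rewrite /openw /= ffunE eqxx /= ltnSn /arcw.
  by case: (t _) (t _) => [] [] /=; rewrite ?mul0r ?mul1r.
have -> : openw (@pos n) q (e_diag i) (ptlab s t) (inl (hi i)) = 1.
  by rewrite /openw /= ffunE eqxx (negPf hl) /= ltnNge leqnSn.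
have -> : openw (@pos n) q (e_diag i) (ptlab s t) (inr (lo i)) = 1.
  by rewrite /openw /= ffunE eqxx /= ifF //; apply/negbTE; lia.
have -> : openw (@pos n) q (e_diag i) (ptlab s t) (inr (hi i)) =
    arcw q (~~ s (hi i)) (~~ s (lo i)).
  by rewrite /openw /= ffunE eqxx (negPf hl) /= ifT //; lia.
have -> : delta q (s (lo i)) (s (hi i)) =
    gluew q (s (lo i)) * gluew q (s (hi i)) * arcw q (~~ s (hi i)) (~~ s (lo i)).
  by case: (s _) (s _) => [] []; rewrite /arcw /gluew /=; field.
by rewrite !mul1r; ring.
Qed.

(* A cup of [D] at the bottom vertices [i, i+1] closes up with the cap of [e_i]. *)
Lemma mulTL_cup D (i : 'I_n.-1) : D (inl (lo i)) = inl (hi i) ->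
  mulTL q (diagTL K D) (eTL i) = beta q *: diagTL K D.
Proof.
move=> Di; apply: opmx_inj => s t; rewrite opmx_mul linearZ /= opmx_diag.
have hl : hi i != lo i by apply/eqP => /(congr1 val) /=; lia.
have lh : lo i != hi i by rewrite eq_sym.
have Dhi : D (inl (hi i)) = inl (lo i) by rewrite -Di diagramK.
(* The weight of everything except the cup at [lo i, hi i]; it does not see the labels there. *)
pose R u := (\prod_j gluew q (s j)) *
  ((\prod_(j | (j != lo i) && (j != hi i)) openw (@pos n) q D (ptlab s u) (inl j)) *
   (\prod_j openw (@pos n) q D (ptlab s u) (inr j))).
have DE u : diagmx q D s u = arcw q (u (lo i)) (u (hi i)) * R u.
  rewrite diagmx_split [X in _ * (X * _)](bigD1 (lo i)) //=.
  rewrite [X in _ * (_ * X * _)](bigD1 (hi i)) //=.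
  have -> : openw (@pos n) q D (ptlab s u) (inl (lo i)) = arcw q (u (lo i)) (u (hi i)).
    by rewrite /openw Di /= ltnSn.
  have -> : openw (@pos n) q D (ptlab s u) (inl (hi i)) = 1.
    by rewrite /openw Dhi /= ltnNge leqnSn.
  by rewrite mul1r /R; ring.
have RE u : (forall j, j != lo i -> j != hi i -> u j = t j) -> R u = R t.
  move=> ut; have other (z : pt n) : z != inl (lo i) -> z != inl (hi i) ->
      openw (@pos n) q D (ptlab s u) z = openw (@pos n) q D (ptlab s t) z.
    have labE (w : pt n) : w != inl (lo i) -> w != inl (hi i) ->
        ptlab s u w = ptlab s t w.
      by case: w => //= j jl jh; exact: ut.
    move=> zl zh; rewrite /openw !labE //.
      by apply: contra zh => /eqP e; rewrite -Di -e diagramK.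
    by apply: contra zl => /eqP e; rewrite -Dhi -e diagramK.
  rewrite /R; congr (_ * (_ * _)); apply: eq_bigr => j; last by rewrite other.
  by move=> /andP[jl jh]; rewrite other.
pose upd (ab : bool * bool) : signs :=
  [ffun j => if j == lo i then ab.1 else if j == hi i then ab.2 else t j].
have term u : opmx s u (diagTL K D) * opmx u t (eTL i) =
    R t * eps q (t (lo i)) (t (hi i)) *
    ((arcw q (u (lo i)) (u (hi i)) * delta q (u (lo i)) (u (hi i))) *
     (upd (u (lo i), u (hi i)) == u)%:R).
  rewrite opmx_diag opmx_e DE.
  have [ue|ue] := eqVneq (upd (u (lo i), u (hi i))) u.
    have ut j : j != lo i -> j != hi i -> u j = t j.
      by move=> /negPf jl /negPf jh; rewrite -ue ffunE jl jh.
    rewrite big1 => [|j /andP[jl jh]]; last by rewrite ut // eqxx.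
    by rewrite RE // mulr1 (_ : true%:R = 1) //; ring.
  have [j /andP[jl jh] jne] : exists2 j, (j != lo i) && (j != hi i) & u j != t j.
    have /existsP[j] : [exists j, (upd (u (lo i), u (hi i))) j != u j].
      rewrite -negb_forall; apply: contra ue => /forallP h.
      by apply/eqP/ffunP => j; exact/eqP.
    have [->|jl] := eqVneq j (lo i); first by rewrite ffunE eqxx /= eqxx.
    have [->|jh] := eqVneq j (hi i); first by rewrite ffunE (negPf hl) eqxx /= eqxx.
    by rewrite ffunE (negPf jl) (negPf jh) eq_sym; exists j => //; rewrite jl.
  by rewrite (bigD1 j) ?jl //= (negPf jne) mul0r !mulr0.
rewrite (eq_bigr _ (fun u _ => term u)) -mulr_sumr.
(* The surviving [u] agree with [t] off the cup, one for each pair of signs on it; the remaining sum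
   over pairs is the loop value. *)
have -> : \sum_(u : signs) (arcw q (u (lo i)) (u (hi i)) * delta q (u (lo i)) (u (hi i)) *
     (upd (u (lo i), u (hi i)) == u)%:R) =
    \sum_(ab : bool * bool) arcw q ab.1 ab.2 * delta q ab.1 ab.2.
  rewrite (bigID (fun u : signs => upd (u (lo i), u (hi i)) == u)) /= addrC big1 => [|u /negPf ->].
    rewrite add0r (reindex_onto upd (fun u : signs => (u (lo i), u (hi i)))) /= => [|u /eqP //].
    have upd1 ab : (upd ab) (lo i) = ab.1 by rewrite ffunE eqxx.
    have upd2 ab : (upd ab) (hi i) = ab.2 by rewrite ffunE (negPf hl) eqxx.
    by apply: eq_big => [ab|ab _]; rewrite upd1 upd2 -surjective_pairing !eqxx ?mulr1.
  by rewrite mulr0.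
rewrite -(pair_bigA _ (fun a b => arcw q a b * delta q a b)) /= !big_bool /=.
rewrite DE /beta [_ *: _]mulrC /arcw /eps /delta.
by case: (t (lo i)) (t (hi i)) => [] [] /=; field.
Qed.

End Operators.

(** * The induced modules *)

Section Modules.
Variables (K : fieldType) (q : K) (n : nat).
Hypothesis q0 : q != 0.
Notation signs := {ffun 'I_n -> bool}.
Notation TL := (TL K n).
Notation tens := (tens K n).
Implicit Types (s t u : signs) (x y : TL) (D : diagram n) (v w : tens).

Definition tlact x v : tens := [ffun s : signs => \sum_t opmx q s t x * v t].

Lemma tlactP (a b : K) x y v w :
  tlact (a *: x + y) v = a *: tlact x v + tlact y v /\
  tlact x (b *: v + w) = b *: tlact x v + tlact x w.
Proof.
split; apply/ffunP => s; rewrite !ffunE scaler_sumr -big_split; apply: eq_bigr => t _ /=.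
  by rewrite linearP mulrDl scalerAl.
by rewrite !ffunE mulrDr scalerAr.
Qed.

Lemma tlact_module : TLmodule q tlact.
Proof.
split.
- by move=> x a v w; have [] := tlactP 0 a x x v w.
- by move=> v a x y; have [] := tlactP a 0 x y v v.
- move=> v; apply/ffunP => s; rewrite ffunE (bigD1 s) //= opmx_one // eqxx mul1r.
  by rewrite big1 ?addr0 // => t ts; rewrite opmx_one // eq_sym (negPf ts) mul0r.
move=> x y v; apply/ffunP => s; rewrite !ffunE.
under eq_bigr => t _ do rewrite opmx_mul // mulr_suml.
rewrite exchange_big; apply: eq_bigr => u _ /=; rewrite ffunE mulr_sumr.
by apply: eq_bigr => t _; rewrite mulrA.
Qed.

Lemma tlact_e (i : 'I_n.-1) v : tlact (eTL i) v = e_tens q i v.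
Proof.
apply/ffunP => s; rewrite ffunE sum_ffunE; apply: eq_bigr => t _.
by rewrite !ffunE opmx_e // mulrC [LHS]mulrA.
Qed.

Lemma mulTL1l x : mulTL q (oneTL K n) x = x.
Proof.
apply: (opmx_inj q0) => s t; rewrite opmx_mul // (bigD1 s) //= opmx_one // eqxx mul1r.
by rewrite big1 ?addr0 // => u us; rewrite opmx_one // eq_sym (negPf us) mul0r.
Qed.

(** By associativity the relations form a left ideal, which makes the action on the quotient well
    defined. *)
Lemma mulTL_bal k x y : y \in bal q k -> mulTL q x y \in bal q k.
Proof.
have lin0 : mulTL q x 0 = 0.
  by have := mulTL_linearr q0 x (-1) 0 0; rewrite scaler0 addr0 scaleN1r addNr.
move=> /asboolP; elim=> [|a y1 y2 _ IH1 _ IH2|y1 b c bc]; apply/asboolP.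
- by rewrite lin0; exact: balanced0.
- by rewrite mulTL_linearr //; apply: balanced_lin; apply/asboolP.
rewrite addrC -scaleNr mulTL_linearr // -mulTLA // scaleNr addrC.
exact: balanced_rel.
Qed.

Lemma Ind_act_tens1 k x y : Ind_act x (tens1 q k y) = tens1 q k (mulTL q x y).
Proof.
apply: tens1_eq; have := mulTL_linearr q0 x (-1) y; rewrite /Ind_act.
move=> /(_ (repr (tens1 q k y : Quotient.quot (bal q k)))).
rewrite !scaleN1r ![- _ + _]addrC => <-; apply: mulTL_bal.
by rewrite Quotient.idealrBE reprK.
Qed.

Lemma tens1_scale k a y : tens1 q k (a *: y) = a *: tens1 q k y.
Proof. exact: tens1Z. Qed.

Lemma tens1_0 k : tens1 q k (0 : TL) = 0.
Proof. by have := tens1_scale k 0 (0 : TL); rewrite !scale0r. Qed.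

Lemma tens1_surj k (m : Ind q n k) : exists y, m = tens1 q k y.
Proof. by exists (repr (m : Quotient.quot (bal q k))); rewrite tens1K. Qed.

Lemma Ind_act_linearr k x : linear (Ind_act x : Ind q n k -> Ind q n k).
Proof.
move=> a m1 m2; have [y1 ->] := tens1_surj m1; have [y2 ->] := tens1_surj m2.
by rewrite -tens1_scale -tens1D !Ind_act_tens1 mulTL_linearr // tens1D tens1_scale.
Qed.

Lemma Ind_act_linearl k (m : Ind q n k) : linear (fun x => Ind_act x m).
Proof.
move=> a x1 x2; have [y ->] := tens1_surj m.
by rewrite !Ind_act_tens1 mulTL_linearl // tens1D tens1_scale.
Qed.

Lemma compP (a : K) (m1 m2 : IndSum q n) k :
  Defs.comp (a *: m1 + m2) k = a *: Defs.comp m1 k + Defs.comp m2 k.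
Proof. exact: etrans (comp_of _ _) (congr1 (+%R^~ _) (comp_of _ _)). Qed.

Lemma IndSum_module : TLmodule q (IndSum_act q (n := n)).
Proof.
split.
- move=> x a m1 m2; apply: IndSum_eqP => k; rewrite comp_of !compP !comp_of.
  exact: Ind_act_linearr.
- move=> m a x y; apply: IndSum_eqP => k; rewrite comp_of compP !comp_of.
  exact: Ind_act_linearl.
- move=> m; apply: IndSum_eqP => k; rewrite comp_of.
  by have [y ->] := tens1_surj (Defs.comp m k); rewrite Ind_act_tens1 mulTL1l.
move=> x y m; apply: IndSum_eqP => k; rewrite !comp_of.
by have [z ->] := tens1_surj (Defs.comp m k); rewrite !Ind_act_tens1 mulTLA.
Qed.

Definition stepv k : tens := vtens K [ffun i : 'I_n => (k <= i)%N].

Lemma tlact_linearl v : linear (fun x => tlact x v).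
Proof. by move=> a x y; have [] := tlactP a 0 x y v v. Qed.

Lemma tlact_linearr x : linear (tlact x).
Proof. by move=> a v w; have [] := tlactP 0 a x x v w. Qed.

Lemma tlact_mul x y v : tlact (mulTL q x y) v = tlact x (tlact y v).
Proof. by have [_ _ _] := tlact_module; apply. Qed.

Lemma tlact0 x : tlact x 0 = 0.
Proof. by have := tlact_linearr x (-1) 0 0; rewrite scaler0 addr0 scaleN1r addNr. Qed.

Lemma tlactZ x a v : tlact x (a *: v) = a *: tlact x v.
Proof. by have := tlact_linearr x a v 0; rewrite tlact0 !addr0. Qed.

Lemma tlact_triv k b c : triv_act q k b c -> tlact b (stepv k) = c *: stepv k.
Proof.
elim=> [|i ik|a x y c1 c2 _ IH1 _ IH2|x y c1 c2 _ IH1 _ IH2].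
- by have [_ _ -> _] := tlact_module; rewrite scale1r.
- rewrite tlact_e scale0r /e_tens big1 // => t _. rewrite /Defs.coord ffunE.
  have [->|_] := eqVneq; last by rewrite mul0r scale0r.
  rewrite !ffunE /=.
  (* As [i.+1 <> k], the step does not occur between vertices [i] and [i+1]; [eps] vanishes on equal
     signs. *)
  have -> : (k <= i.+1)%N = (k <= i)%N by lia.
  by case: (k <= i)%N; rewrite /= mulr0 scale0r.
- by rewrite tlact_linearl IH1 IH2 scalerA -scalerDl.
by rewrite tlact_mul IH2 tlactZ IH1 scalerA mulrC.
Qed.

Lemma tlact_bal k x : x \in bal q k -> tlact x (stepv k) = 0.
Proof.
have lin0 : tlact 0 (stepv k) = 0.
  by have := tlact_linearl (stepv k) (-1) 0 0; rewrite scaler0 addr0 scaleN1r addNr.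
move=> /asboolP; elim=> [|a y1 y2 _ IH1 _ IH2|y b c bc]; first exact: lin0.
  by rewrite tlact_linearl IH1 IH2 scaler0 addr0.
rewrite addrC -scaleNr tlact_linearl tlact_mul (tlact_triv bc) tlactZ.
by rewrite scaleNr addNr.
Qed.

Definition indmap k (m : Ind q n k) : tens :=
  tlact (repr (m : Quotient.quot (bal q k))) (stepv k).

Lemma indmap_tens1 k y : indmap (tens1 q k y) = tlact y (stepv k).
Proof.
apply/eqP; rewrite -subr_eq0 -[- _]scaleN1r addrC -tlact_linearl scaleN1r addrC.
apply/eqP/tlact_bal; by rewrite Quotient.idealrBE reprK.
Qed.

Lemma indmap_linear k : linear (@indmap k).
Proof.
move=> a m1 m2; have [y1 ->] := tens1_surj m1; have [y2 ->] := tens1_surj m2.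
by rewrite -tens1_scale -tens1D !indmap_tens1 tlact_linearl.
Qed.

Definition indsum_map (m : IndSum q n) : tens := \sum_k indmap (Defs.comp m k).

Lemma indsum_map_linear : linear indsum_map.
Proof.
move=> a m1 m2; rewrite /indsum_map scaler_sumr -big_split; apply: eq_bigr => k _ /=.
by rewrite compP indmap_linear.
Qed.

Lemma indsum_map_act x m : indsum_map (IndSum_act q x m) = tlact x (indsum_map m).
Proof.
have -> : tlact x (indsum_map m) = \sum_k tlact x (indmap (Defs.comp m k)).
  apply: (big_morph (tlact x)) => [v w|]; last exact: tlact0.
  by have := tlact_linearr x 1 v w; rewrite !scale1r.
apply: eq_bigr => k _; rewrite comp_of.
by have [y ->] := tens1_surj (Defs.comp m k); rewrite Ind_act_tens1 !indmap_tens1 tlact_mul.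
Qed.

Definition ind_diagram k D : bool :=
  [forall i : 'I_n, forall j : 'I_n, (D (inl i) == inl j) ==>
    ~~ ((i < k)%N && (j < k)%N) && ~~ ((k <= i)%N && (k <= j)%N)].

Lemma ind_diagramP k D : reflect (Ind_diagram k D) (ind_diagram k D).
Proof.
apply: (iffP forallP) => [h i j Dij|h i].
  have /forallP /(_ j) := h i; rewrite Dij eqxx /= => /andP[/negP h1 /negP h2].
  by split=> -[? ?]; [apply: h1|apply: h2]; apply/andP.
apply/forallP => j; apply/implyP => /eqP Dij; have [h1 h2] := h i j Dij.
by apply/andP; split; apply/negP => /andP.
Qed.

(** The link at [i+1] stays under the link from [i] to [j] and is shorter. The bounds on [l] keep
    the innermost cup on the same side of [k]. *)
Lemma cup_innermost D (i j : 'I_n) : D (inl i) = inl j -> (i < j)%N ->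
  exists l : 'I_n.-1, [/\ (i <= l)%N, (l < j)%N & D (inl (lo l)) = inl (hi l)].
Proof.
have [d] := ubnP (j - i); elim: d i j => // d IH i j ijd Dij ij.
have iS : (i.+1 < n)%N by have := ltn_ord j; lia.
have [jE|jne] := eqVneq (i.+1) (j : nat).
  have il : (i < n.-1)%N by lia.
  exists (Ordinal il); split=> //=.
  have -> : lo (Ordinal il) = i by apply: val_inj.
  by rewrite Dij; congr inl; apply: val_inj; rewrite /= jE.
have bw := ncm_between (@pos_inj n) (diagram_ncm D) (in_setT (inl i)) (in_setT (inl (Ordinal iS))).
rewrite Dij /= in bw; have {bw} := bw ltac:(lia).
case Dc : (D (inl (Ordinal iS))) => [c|c] /=; last by have := ltn_ord j; lia.
have cne : c != i.+1 :> nat.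
  apply/eqP => cE; have := diagram_neq D (inl (Ordinal iS)); rewrite Dc.
  by rewrite (_ : c = Ordinal iS) ?eqxx //; apply: val_inj.
move=> icj; have [||l [l1 l2 Dl]] := IH (Ordinal iS) c _ Dc; try by rewrite /=; lia.
by exists l; split=> //; rewrite /= in l1; lia.
Qed.

(** With an innermost cup at [l] one has [D e_l = beta D], and [e_l] passes through the tensor sign
    to act by 0. *)
Lemma tens1_cup k D : beta q != 0 -> ~~ ind_diagram k D -> tens1 q k (diagTL K D) = 0.
Proof.
move=> b0 /forallPn[i /forallPn[j]]; rewrite negb_imply => /andP[/eqP Dij].
rewrite negb_and !negbK => side.
wlog ij : i j Dij side / (i < j)%N.
  move=> wl; case: (ltngtP i j) => [|ji|/val_inj e]; first exact: wl.
    by apply: (wl j i) => //; rewrite -?Dij ?diagramK // andbC [X in _ || X]andbC.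
  by have := diagram_neq D (inl i); rewrite Dij e eqxx.
have [l [il lj Dl]] := cup_innermost Dij ij.
have lk : l.+1 <> k by lia.
have : tens1 q k (mulTL q (diagTL K D) (eTL l) - 0 *: diagTL K D) = tens1 q k 0.
  by apply: tens1_eq; rewrite subr0; apply/asboolP/balanced_rel/triv_act_gen.
rewrite scale0r subr0 mulTL_cup // tens1_scale.
by rewrite tens1_0; move/eqP; rewrite scaler_eq0 (negPf b0) => /eqP.
Qed.

Lemma tens1_expand k y : beta q != 0 ->
  tens1 q k y = \sum_(D | ind_diagram k D) coefTL y D *: tens1 q k (diagTL K D).
Proof.
move=> b0; rewrite [RHS]big_mkcond /=.
have {1}-> : y = \sum_D coefTL y D *: diagTL K D.
  apply/ffunP => D; rewrite sum_ffunE (bigD1 D) //= big1 => [|D1 /negPf DD1].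
    by rewrite !ffunE eqxx addr0 -[RHS]/(_ * _) mulr1.
  by rewrite !ffunE eq_sym DD1 -[LHS]/(_ * _) mulr0.
rewrite (big_morph _ (@tens1D _ q n k) (tens1_0 k)).
apply: eq_bigr => D _; rewrite tens1_scale.
by case: ifP => [_ //|/negbT kD]; rewrite tens1_cup // scaler0.
Qed.

End Modules.

(** * The bar involution and caps *)

Section DualCanonical.
Variables (K : fieldType) (q : K).
Hypothesis q0 : q != 0.
Notation signs m := {ffun 'I_m -> bool}.
Notation tens := (tens K).

Definition signs_rcons m (t : signs m) (b : bool) : signs m.+1 :=
  [ffun j => if unlift ord_max j is Some l then t l else b].

Lemma widen_lift m (j : 'I_m) : widen_ord (leqnSn m) j = lift ord_max j.
Proof. by apply: val_inj; rewrite /= /bump leqNgt ltn_ord. Qed.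

Lemma signs_rcons_widen m (t : signs m) b j :
  signs_rcons t b (widen_ord (leqnSn m) j) = t j.
Proof. by rewrite ffunE widen_lift liftK. Qed.

Lemma signs_rcons_max m (t : signs m) b : signs_rcons t b ord_max = b.
Proof. by rewrite ffunE unlift_none. Qed.

Lemma big_signs_recr m (F : signs m.+1 -> K) :
  \sum_t F t = \sum_t \sum_b F (signs_rcons t b).
Proof.
rewrite pair_bigA /=.
rewrite (reindex (fun p : signs m * bool => signs_rcons p.1 p.2)) //=.
exists (fun t => ([ffun j => t (widen_ord (leqnSn m) j)], t ord_max)) => [[t b]|t] _ /=.
  rewrite signs_rcons_max; congr (_, _); apply/ffunP => j.
  by rewrite ffunE signs_rcons_widen.
apply/ffunP => j; rewrite ffunE; case: unliftP => [l ->|-> //].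
by rewrite ffunE widen_lift.
Qed.

Lemma tensop_tensr m (A : 'I_m.+1 -> V K -> V K) (x : tens m) (v : V K) :
  (forall c, A ord_max v c = \sum_b v b * A ord_max (vv K b) c) ->
  tensop A (tensr x v) =
    tensr (tensop (fun j => A (widen_ord (leqnSn m) j)) x) (A ord_max v).
Proof.
move=> Av; apply/ffunP => s; rewrite /tensop [RHS]ffunE !sum_ffunE big_signs_recr.
rewrite mulr_suml; apply: eq_bigr => t _; rewrite Av mulr_sumr; apply: eq_bigr => b _.
move: (signs_rcons t b) (signs_rcons_max t b) (signs_rcons_widen t b) => u um uw.
rewrite /Defs.coord !ffunE big_ord_recr /= um.
have -> : [ffun j => u (widen_ord (leqnSn m) j)] = t by apply/ffunP => j; rewrite ffunE uw.
under eq_bigr => j _ do rewrite uw.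
under [in RHS]eq_bigr => j _ do rewrite ffunE.
by rewrite -![_ *: _]/(_ * _); ring.
Qed.

Lemma eq_tensop m (A B : 'I_m -> V K -> V K) (x : tens m) :
  (forall j v, A j v = B j v) -> tensop A x = tensop B x.
Proof.
move=> AB; apply: eq_bigr => t _; congr (_ *: _); apply/ffunP => s; rewrite !ffunE.
by apply: eq_bigr => j _; rewrite AB.
Qed.

Lemma tensop_id m (x : tens m) : tensop (fun=> id) x = x.
Proof.
apply/ffunP => s; rewrite sum_ffunE (bigD1 s) //= big1 => [|t ts].
  rewrite !ffunE big1 => [|j _]; first by rewrite addr0 -[LHS]/(_ * _) mulr1.
  by rewrite ffunE eqxx.
have /existsP[j tj] : [exists j, t j != s j].
  rewrite -negb_forall; apply: contra ts => /forallP h.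
  by apply/eqP/ffunP => j; exact/eqP.
by rewrite !ffunE (bigD1 j) //= ffunE eq_sym (negPf tj) mul0r -[LHS]/(_ * _) mulr0.
Qed.

(** The coproduct rule for [F], splitting off the last factor as the recursion for [psi] does. *)
Lemma F_tensr m (x : tens m) v :
  F_tens q (tensr x v) = tensr (F_tens q x) (K_V q v) + tensr x (F_V v).
Proof.
have lin (A : V K -> V K) : A = K_V q \/ A = @F_V K \/ A = id ->
    forall c, A v c = \sum_b v b * A (vv K b) c.
  by case=> [->|[->|->]] [] /=; rewrite big_bool !ffunE /= ?ffunE /=; ring.
rewrite {1}/F_tens big_ord_recr /=; congr (_ + _); last first.
  rewrite tensop_tensr ltnn eqxx; last by apply: lin; auto.
  congr tensr; rewrite -[RHS]tensop_id; apply: eq_tensop => j w.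
  by rewrite /= ltn_ord.
have tensr_sum (I : finType) (G : I -> tens m) w :
    tensr (\sum_i G i) w = \sum_i tensr (G i) w.
  by apply/ffunP => s; rewrite !ffunE !sum_ffunE mulr_suml; apply: eq_bigr => i _; rewrite ffunE.
rewrite /F_tens tensr_sum; apply: eq_bigr => j _.
have maxj : (@ord_max m < widen_ord (leqnSn m) j)%N = false.
  by apply/negbTE; rewrite -leqNgt; exact: ltnW (ltn_ord j).
have maxj' : (@ord_max m == widen_ord (leqnSn m) j) = false.
  by apply/eqP => /(congr1 val) /= e; have := ltn_ord j; rewrite -e ltnn.
rewrite tensop_tensr maxj maxj'; last by apply: lin; auto.
by congr tensr; apply: eq_tensop => l w.
Qed.

Lemma tensrD m (x y : tens m) v : tensr (x + y) v = tensr x v + tensr y v.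
Proof. by have := tensrP 1 x y v; rewrite !scale1r. Qed.

Lemma tensrZ m a (x : tens m) v : tensr (a *: x) v = a *: tensr x v.
Proof. by apply/ffunP => s; rewrite !ffunE -!mulrA. Qed.

Lemma tensrZr m a (x : tens m) (v : V K) : tensr x (a *: v) = a *: tensr x v.
Proof. by apply/ffunP => s; rewrite !ffunE -![_ *: _]/(_ * _) mulrCA. Qed.

Lemma tensr0 m (x : tens m) : tensr x (0 : V K) = 0.
Proof. by apply/ffunP => s; rewrite !ffunE mulr0. Qed.

Lemma F_tensD m (x y : tens m) : F_tens q (x + y) = F_tens q x + F_tens q y.
Proof. by have := F_tensP q 1 x y; rewrite !scale1r. Qed.

Lemma F_tens0 m : F_tens q (0 : tens m) = 0.
Proof. by have := F_tensP q (-1) (0 : tens m) 0; rewrite scaler0 addr0 scaleN1r addNr. Qed.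

Lemma F_tensZ m a (x : tens m) : F_tens q (a *: x) = a *: F_tens q x.
Proof. by have := F_tensP q a x 0; rewrite F_tens0 !addr0. Qed.

(** Sign sequences extended to all naturals, so that shifted indices carry no bound proofs; the
    default [true] is only a filler. *)
Definition ext m (t : signs m) (x : nat) : bool :=
  if insub x is Some i then t i else true.

Lemma ext_ord m (t : signs m) (i : 'I_m) : ext t i = t i.
Proof. by rewrite /ext valK. Qed.

Lemma ext_nat m (t : signs m) x (xm : (x < m)%N) : ext t x = t (Ordinal xm).
Proof. by rewrite -(ext_ord t (Ordinal xm)). Qed.

Lemma ext_fun m (u : nat -> bool) x : (x < m)%N -> ext [ffun j : 'I_m => u j] x = u x.
Proof. by move=> xm; rewrite (ext_nat _ xm) ffunE. Qed.

Lemma ext_widen m (t : signs m.+1) x : (x < m)%N ->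
  ext [ffun j => t (widen_ord (leqnSn m) j)] x = ext t x.
Proof.
move=> xm; rewrite (ext_nat _ xm) ffunE (ext_nat _ (ltnW xm : (x < m.+1)%N)).
by congr (t _); apply: val_inj.
Qed.

Definition skip2 (i j : nat) : nat := if (j < i)%N then j else j.+2.

(** This is [delta] applied between the first [i] factors and the rest; [skip2 i] enumerates the
    places of the old factors. *)
Definition insert_cap m (i : nat) (x : tens m) : tens m.+2 :=
  [ffun t => delta q (ext t i) (ext t i.+1) * x [ffun j : 'I_m => ext t (skip2 i j)]].

Lemma insert_capD m i (x y : tens m) :
  insert_cap i (x + y) = insert_cap i x + insert_cap i y.
Proof. by apply/ffunP => s; rewrite !ffunE mulrDr. Qed.

Lemma insert_cap_tensr m i (x : tens m) v : (i <= m)%N ->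
  insert_cap i (tensr x v) = tensr (insert_cap i x) v.
Proof.
move=> im; apply/ffunP => s; rewrite !ffunE !ext_widen ?mulrA; try lia.
congr (_ * x _ * v _); last first.
  by rewrite /skip2 ltnNge im /= -ext_ord.
by apply/ffunP => j; rewrite !ffunE /= ext_widen // /skip2; have := ltn_ord j; case: ifP; lia.
Qed.

Lemma insert_cap_end m (x : tens m) : insert_cap m x =
  tensr (tensr x (vv K true)) (vv K false) + - q^-1 *: tensr (tensr x (vv K false)) (vv K true).
Proof.
apply/ffunP => s; rewrite !ffunE.
have -> : ext s m.+1 = s ord_max by rewrite -ext_ord.
have -> : ext s m = s (widen_ord (leqnSn m.+1) ord_max) by rewrite -ext_ord.
have -> : [ffun j : 'I_m => ext s (skip2 m j)] =
    [ffun j => [ffun j0 => s (widen_ord (leqnSn m.+1) j0)] (widen_ord (leqnSn m) j)].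
  by apply/ffunP => j; rewrite !ffunE -ext_ord /skip2 ltn_ord.
rewrite -![_ *: _]/(_ * _).
by case: (s ord_max) (s _) => [] []; rewrite /delta /=; ring.
Qed.

Lemma FV_true : F_V (vv K true) = vv K false.
Proof. by apply/ffunP => -[]; rewrite !ffunE. Qed.
Lemma FV_false : F_V (vv K false) = 0.
Proof. by apply/ffunP => -[]; rewrite !ffunE. Qed.
Lemma EV_true : E_V (vv K true) = 0.
Proof. by apply/ffunP => -[]; rewrite !ffunE. Qed.
Lemma EV_false : E_V (vv K false) = vv K true.
Proof. by apply/ffunP => -[]; rewrite !ffunE. Qed.
Lemma KV_true : K_V q (vv K true) = q *: vv K true.
Proof. by apply/ffunP => -[]; rewrite !ffunE /= ?scaler0 ?mulr0. Qed.
Lemma KV_false : K_V q (vv K false) = q^-1 *: vv K false.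
Proof. by apply/ffunP => -[]; rewrite !ffunE /= ?scaler0 ?mulr0. Qed.

Lemma tens_split m (x : tens m.+1) :
  x = tensr (lastcomp true x) (vv K true) + tensr (lastcomp false x) (vv K false).
Proof. by rewrite {1}(tensr_lastcomp x) big_bool. Qed.

(** The cap spans a trivial module: [F] kills it and [K] fixes it. This is computed for a cap in the
    last two places; factors to its right are peeled off by induction. *)
Lemma F_insert_cap m i (x : tens m) : (i <= m)%N ->
  F_tens q (insert_cap i x) = insert_cap i (F_tens q x).
Proof.
elim: m x => [|m IH] x; rewrite leq_eqVlt => /orP[/eqP->|im] //.
1,2: rewrite !insert_cap_end F_tensD F_tensZ !F_tensr ?FV_true ?FV_false ?KV_true ?KV_false.
1,2: rewrite ?(tensr0, tensrD, tensrZ, tensrZr) !addr0; apply/ffunP => s; rewrite !ffunE.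
1,2: rewrite -![_ *: _]/(_ * _); field; exact: q0.
rewrite [x in LHS]tens_split [x in RHS]tens_split !(insert_capD, F_tensD).
have step (y : tens m) b : F_tens q (insert_cap i (tensr y (vv K b))) =
    insert_cap i (F_tens q (tensr y (vv K b))).
  by rewrite insert_cap_tensr // !F_tensr insert_capD !insert_cap_tensr // IH.
by rewrite !step.
Qed.

Variable bar : {rmorphism K -> K}.
Hypothesis barq : bar q = q^-1.
Notation psi := (psi q bar).

Lemma psiD m (x y : tens m) : psi (x + y) = psi x + psi y.
Proof. by have := psi_antilinear q bar 1 x y; rewrite rmorph1 !scale1r. Qed.

Lemma psi0 m : psi (0 : tens m) = 0.
Proof. by apply: (addIr (psi 0)); rewrite -psiD addr0 add0r. Qed.

Lemma psiZ m a (x : tens m) : psi (a *: x) = bar a *: psi x.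
Proof. by have := psi_antilinear q bar a x 0; rewrite psi0 !addr0. Qed.

(** For a cap in the last two places, antilinearity turns the coefficient [- q^-1] into [- q]; the
    correction of [psi] adds [q - q^-1] and restores it, and the two terms in [F (psi x)] cancel.
    Further factors to the right use that [F] commutes with the insertion. *)
Lemma psi_insert_cap m i (x : tens m) : (i <= m)%N ->
  psi (insert_cap i x) = insert_cap i (psi x).
Proof.
have at_end k (y : tens k) : psi (insert_cap k y) = insert_cap k (psi y).
  rewrite !insert_cap_end psiD psiZ !psi_tensr EV_true EV_false.
  rewrite ?(tensr0, scaler0, addr0) F_tensr FV_true KV_true rmorphN fmorphV barq invrK.
  rewrite ?(tensr0, tensrD, tensrZ, tensrZr, addr0, scaler0).
  apply/ffunP => s; rewrite !ffunE -![_ *: _]/(_ * _); field; exact: q0.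
elim: m x => [|m IH] x; rewrite leq_eqVlt => /orP[/eqP->|im] //.
rewrite [x in LHS]tens_split [x in RHS]tens_split !(insert_capD, psiD).
have insert_capZ k a (z : tens k) : insert_cap i (a *: z) = a *: insert_cap i z.
  by apply/ffunP => s; rewrite !ffunE -![_ *: _]/(_ * _) mulrCA.
have step (y : tens m) b : psi (insert_cap i (tensr y (vv K b))) =
    insert_cap i (psi (tensr y (vv K b))).
  rewrite insert_cap_tensr // !psi_tensr insert_capD insert_capZ !insert_cap_tensr //.
  by rewrite IH // F_insert_cap.
by rewrite !step.
Qed.

End DualCanonical.

(** * Vectors built from caps and through links *)

Section CapVectors.
Variables (K : fieldType) (q : K).
Hypothesis q0 : q != 0.
Notation signs m := {ffun 'I_m -> bool}.
Notation tens := (tens K).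
Implicit Types (f : nat -> nat) (s : nat -> bool).

(* The arcs of [f] on [0, m) are caps, its fixed points are through links, and
   [s] is the sign sequence of the dual canonical basis vector they produce. *)
Record capped m f s : Prop := Capped {
  cap_in : forall x, (x < m)%N -> (f x < m)%N;
  capK : forall x, (x < m)%N -> f (f x) = x;
  cap_nc : forall x y, (x < m)%N -> (y < m)%N -> ~ (x < y < f x /\ f x < f y)%N;
  cap_under : forall x y, (x < m)%N -> (y < m)%N -> (x < y < f x)%N -> f y <> y;
  cap_open : forall x, (x < m)%N -> (x < f x)%N -> s x;
  cap_close : forall x, (x < m)%N -> (f x < x)%N -> ~~ s x;
  cap_fix : forall x y, (x < y < m)%N -> f x = x -> f y = y -> s x -> s y }.

Definition capw f s (t : nat -> bool) x : K :=
  if (x < f x)%N then delta q (t x) (t (f x))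
  else if f x == x then (t x == s x)%:R else 1.

Definition capvec m f s : tens m := [ffun t => \prod_(x < m) capw f s (ext t) x].

Lemma big_skip2 m i (G : nat -> K) : (i <= m)%N ->
  \prod_(x < m.+2) G x = G i * G i.+1 * \prod_(x < m) G (skip2 i x).
Proof.
have at_end k : \prod_(x < k.+2) G x = G k * G k.+1 * \prod_(x < k) G (skip2 k x).
  rewrite 2!big_ord_recr /= -mulrA mulrC; congr (_ * _).
  by apply: eq_bigr => x _; rewrite /skip2 ltn_ord.
elim: m => [|m IH]; rewrite leq_eqVlt => /orP[/eqP->|im] //.
rewrite big_ord_recr IH // [in RHS]big_ord_recr /= mulrA.
by rewrite {3}/skip2 ltnNge -ltnS im.
Qed.

Definition unskip2 (i j : nat) : nat := if (j < i)%N then j else j.-2.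

Section RemoveCap.
Variables (m i : nat) (f : nat -> nat) (s : nat -> bool).
Hypotheses (fs : capped m.+2 f s) (fi : f i = i.+1) (im : (i <= m)%N).

Let f' x := unskip2 i (f (skip2 i x)).
Let s' x := s (skip2 i x).

Lemma skip2_capE x : (x < m)%N -> f (skip2 i x) = skip2 i (f' x) /\ (f' x < m)%N.
Proof.
rewrite /f'.
move=> xm; have xm2 : (skip2 i x < m.+2)%N by rewrite /skip2; case: ifP; lia.
have fin := cap_in fs xm2; have fK := capK fs xm2.
have fiS : f i.+1 = i by rewrite -fi (capK fs) //; lia.
have ni : f (skip2 i x) <> i.
  by move=> e; move: fK; rewrite e fi /skip2; case: ifP; lia.
have niS : f (skip2 i x) <> i.+1.
  by move=> e; move: fK; rewrite e fiS /skip2; case: ifP; lia.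
move: (f (skip2 i x)) fin ni niS (im) => y fin ni niS le_im.
by rewrite /skip2 /unskip2; split; repeat case: ifP; lia.
Qed.

Lemma skip2_lt x y : (skip2 i x < skip2 i y)%N = (x < y)%N.
Proof. by rewrite /skip2; do 2![case: ifP]; lia. Qed.

Lemma skip2_inj : injective (skip2 i).
Proof. by move=> x y; rewrite /skip2; do 2![case: ifP]; lia. Qed.

Lemma skip2_bound x : (x < m)%N -> (skip2 i x < m.+2)%N.
Proof. by rewrite /skip2; case: ifP; lia. Qed.

Lemma remove_cap : capped m f' s'.
Proof.
split.
- by move=> x /skip2_capE[].
- move=> x xm; have [e h] := skip2_capE xm; have [e' h'] := skip2_capE h.
  by apply: skip2_inj; rewrite -e' -e (capK fs) // skip2_bound.
- move=> x y xm ym; have [e h] := skip2_capE xm; have [e' h'] := skip2_capE ym.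
  have := cap_nc fs (skip2_bound xm) (skip2_bound ym).
  by rewrite e e' !skip2_lt.
- move=> x y xm ym; have [e h] := skip2_capE xm; have [e' h'] := skip2_capE ym.
  have := cap_under fs (skip2_bound xm) (skip2_bound ym).
  by rewrite e e' !skip2_lt => + xy fy; move/(_ xy); apply; rewrite fy.
- move=> x xm; have [e h] := skip2_capE xm.
  by have := cap_open fs (skip2_bound xm); rewrite e skip2_lt.
- move=> x xm; have [e h] := skip2_capE xm.
  by have := cap_close fs (skip2_bound xm); rewrite e skip2_lt.
move=> x y /andP[xy ym] fx fy; have xm := ltn_trans xy ym.
have [e h] := skip2_capE xm; have [e' h'] := skip2_capE ym.
apply: (cap_fix fs); first by rewrite skip2_lt xy skip2_bound.
  by rewrite e fx.
by rewrite e' fy.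
Qed.

(** An innermost cap occupies adjacent places, so it factors out; what is left is again [capped],
    which permits induction. *)
Lemma capvec_insert : capvec m.+2 f s = insert_cap q i (capvec m f' s').
Proof.
apply/ffunP => t; rewrite !ffunE (big_skip2 _ im).
have fiS : f i.+1 = i by rewrite -fi (capK fs) //; lia.
rewrite {1}/capw fi ltnSn {1}/capw fiS ltnNge leqnSn ltn_eqF // mulr1; congr (_ * _).
apply: eq_bigr => x _; have [e h] := skip2_capE (ltn_ord x).
rewrite /capw e skip2_lt (inj_eq skip2_inj).
by rewrite !(ext_fun (fun j => ext t (skip2 i j))).
Qed.

End RemoveCap.

(** The place [x+1] under a longer cap is not a through link, and its partner also lies under that
    cap. *)
Lemma cap_innermost m f s x : capped m f s -> (x < m)%N -> (x < f x)%N ->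
  exists2 i, (i.+1 < m)%N & f i = i.+1.
Proof.
move=> fs; have [d] := ubnP (f x - x); elim: d x => // d IH x fxd xm xfx.
have fxm := cap_in fs xm.
have [fx|fx] := eqVneq (f x) x.+1; first by exists x => //; rewrite -fx.
have Sxm : (x.+1 < m)%N by lia.
have nf := cap_under fs xm Sxm ltac:(lia).
have n1 := cap_nc fs xm Sxm.
have n2 := cap_nc fs (cap_in fs Sxm) xm; rewrite (capK fs Sxm) in n2.
have n3 : f x.+1 <> x by move=> e; have := capK fs Sxm; rewrite e; lia.
have n4 : f x.+1 <> f x by move=> e; have := capK fs Sxm; rewrite e (capK fs xm); lia.
by apply: (IH x.+1) => //; lia.
Qed.

Variable bar : {rmorphism K -> K}.
Hypothesis barq : bar q = q^-1.

(** Caps are removed one at a time. Without caps the vector is a basis tensor with all minus signs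
    before the plus signs. Each correction of [psi] then vanishes: [E] kills v_+, and in front of a
    v_- there are only minus signs, on which [F] is 0. *)
Lemma psi_capvec m f s : capped m f s -> psi q bar (capvec m f s) = capvec m f s.
Proof.
have [d] := ubnP m; elim: d m f s => // d IH m f s md fs.
case: (pselect (exists2 x, (x < m)%N & (x < f x)%N)) => [[x xm xfx]|nocap].
  have [i im fi] := cap_innermost fs xm xfx.
  case: m => [|[|m]] // in md fs xm im *.
  rewrite (capvec_insert fs fi im) psi_insert_cap // IH //; first by lia.
  exact: remove_cap fs fi im.
have fixed x : (x < m)%N -> f x = x.
  move=> xm; case: (ltngtP x (f x)) => // h; first by case: nocap; exists x.
  by case: nocap; exists (f x); rewrite ?(cap_in fs) // (capK fs).
have sorted x y : (x < y < m)%N -> s x -> s y.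
  by move=> xy; apply: (cap_fix fs xy); apply: fixed; lia.
have recr k : (k.+1 <= m)%N ->
    capvec k.+1 f s = tensr (capvec k f s) (vv K (s k)).
  move=> km; apply/ffunP => t; rewrite !ffunE big_ord_recr /=; congr (_ * _).
    apply: eq_bigr => x _; have xk := ltn_ord x.
    by rewrite /capw !ext_widen ?fixed //; lia.
  by rewrite /capw fixed // ltnn eqxx (ext_ord t ord_max).
have killed k : (k <= m)%N -> (forall x, (x < k)%N -> ~~ s x) -> F_tens q (capvec k f s) = 0.
  elim: k => [|k IHk] km sk; first by rewrite /F_tens big_ord0.
  rewrite recr // F_tensr // (negPf (sk k _)) // FV_false tensr0 addr0 IHk.
  - by apply/ffunP => t; rewrite !ffunE mul0r.
  - exact: ltnW.
  by move=> x xk; apply: sk; exact: ltnW.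
elim: m {md fs nocap} fixed sorted recr killed => [|m IHm] fixed sorted recr killed.
  by apply/ffunP => t; rewrite !ffunE !big_ord0; exact: rmorph1.
rewrite recr // psi_tensr IHm; first last.
- by move=> k km; apply: killed; exact: ltnW.
- by move=> k km; apply: recr; exact: ltnW.
- by move=> x y /andP[xy ym]; apply: sorted; rewrite xy ltnW.
- by move=> x xm; apply: fixed; exact: ltnW.
case sm: (s m); first by rewrite EV_true tensr0 scaler0 addr0.
rewrite killed ?leqnSn //.
  rewrite (_ : tensr 0 _ = 0) ?scaler0 ?addr0 //.
  by apply/ffunP => t; rewrite !ffunE mul0r.
move=> x xm; apply/negP => sx; have := sorted x m; rewrite xm ltnSn sx sm.
by move/(_ isT isT).
Qed.

Definition signs_of m s : signs m := [ffun j : 'I_m => s j].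

Lemma capvec_neq0 m f s (t : signs m) x : capped m f s -> capvec m f s t != 0 ->
  (x < m)%N -> (f x = x -> ext t x = s x) /\ (f x <> x -> ext t (f x) = ~~ ext t x).
Proof.
move=> fs; rewrite ffunE => /prodf_neq0 nz.
have key y : (y < m)%N -> capw f s (ext t) y != 0 by move=> ym; exact: (nz (Ordinal ym)).
have up y : (y < m)%N -> (y < f y)%N -> ext t (f y) = ~~ ext t y.
  move=> ym yfy; have := key _ ym; rewrite /capw yfy.
  by case: (ext t y) (ext t (f y)) => [] []; rewrite /= ?eqxx.
move=> xm; split=> [fx|/eqP].
  have := key _ xm; rewrite /capw fx ltnn eqxx.
  by case: (ext t x =P s x) => // _; rewrite mulr0n eqxx.
rewrite neq_ltn => /orP[fxx|]; last exact: up.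
by have := up (f x) (cap_in fs xm); rewrite (capK fs xm) => /(_ fxx) ->; rewrite negbK.
Qed.

Lemma capvec_diag m f s : capped m f s -> capvec m f s (signs_of m s) = 1.
Proof.
move=> fs; rewrite ffunE big1 // => x _; have xm := ltn_ord x.
rewrite /capw !(ext_fun s) ?(cap_in fs) //.
case: ifP => [xfx|_]; last by case: ifP => //; rewrite eqxx.
rewrite (cap_open fs xm xfx); have := cap_close fs (cap_in fs xm).
by rewrite (capK fs xm) => /(_ xfx) /negPf ->.
Qed.

(** A cap contributes 1 in its leading orientation and [- q^-1] when reversed; a sequence in the
    support other than the leading one reverses at least one cap. *)
Lemma capvec_coef m f s (t : signs m) : capped m f s ->
  t != signs_of m s -> qinvZ q (capvec m f s t).
Proof.
move=> fs ts; have [->|nz] := eqVneq (capvec m f s t) 0.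
  by exists 0; rewrite rmorph0 horner0 mulr0.
pose a (x : 'I_m) : nat := (x < f x)%N && ~~ ext t x.
have capE : capvec m f s t = \prod_x (- q^-1) ^+ a x.
  rewrite ffunE; apply: eq_bigr => x _; have [h1 h2] := capvec_neq0 fs nz (ltn_ord x).
  rewrite /capw /a; case: (ltngtP x (f x)) => [xfx|xfx|/esym fx] //=.
    by rewrite h2; [case: (ext t x)|lia].
  by rewrite h1 // eqxx.
have [r rE] : exists r, (\sum_x a x = r.+1)%N.
  case sa: (\sum_x a x)%N => [|r]; last by exists r.
  move/eqP: ts; case; apply/ffunP => x; rewrite ffunE -(ext_ord t).
  have a0 (y : 'I_m) : (y < f y)%N -> ext t y.
    move=> yfy; move/eqP: sa; rewrite sum_nat_eq0 => /forallP /(_ y) /=.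
    by rewrite /a yfy /= eqb0 negbK.
  have [h1 h2] := capvec_neq0 fs nz (ltn_ord x).
  case: (ltngtP x (f x)) => [xfx|xfx|/esym fx]; last exact: h1.
    by rewrite a0 // (cap_open fs).
  have fxm := cap_in fs (ltn_ord x).
  have := a0 (Ordinal fxm); rewrite /= (capK fs) // => /(_ xfx).
  rewrite h2; last by lia.
  by move=> /negPf ->; rewrite (negPf (cap_close fs _ xfx)).
(* With [r.+1] reversed caps, one factor [q^-1] is the one split off in [qinvZ]. *)
exists ((-1) ^+ r.+1 *: 'X^r).
rewrite capE -expr_sum rE map_polyZ map_polyXn hornerZ hornerXn rmorphXn rmorphN1.
by rewrite -[- q^-1]mulN1r [in LHS]exprMn [q^-1 ^+ r.+1]exprS mulrCA.
Qed.

(** Among the rightmost places, a cap lying wholly inside has sign sum 0 in either orientation. A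
    cap that is cut contributes only its right end, which is minus in the leading sequence and so
    can only grow. *)
Lemma capvec_dominates m f s (t : signs m) : capped m f s ->
  capvec m f s t != 0 -> dominates t (signs_of m s).
Proof.
move=> fs nz; pose fo (j : 'I_m) := Ordinal (cap_in fs (ltn_ord j)).
have foK : involutive fo by move=> j; apply: val_inj; rewrite /= (capK fs).
pose d (j : 'I_m) : int := (if t j then 1 else -1) - (if s j then 1 else -1).
have dfo j : d (fo j) = - d j.
  have [h1 h2] := capvec_neq0 fs nz (ltn_ord j); rewrite /d -!(ext_ord t) /=.
  have [fj|/eqP fj] := eqVneq (f j) j; first by rewrite fj h1 // subrr.
  rewrite h2 //; have o1 := cap_open fs (ltn_ord j); have c1 := cap_close fs (ltn_ord j).
  have o2 := cap_open fs (cap_in fs (ltn_ord j)).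
  have c2 := cap_close fs (cap_in fs (ltn_ord j)); rewrite (capK fs) // in o2 c2.
  case: (ltngtP j (f j)) => [jf|jf|e]; last by case: fj.
    by rewrite (o1 jf) (negPf (c2 jf)); case: (ext t j).
  by rewrite (negPf (c1 jf)) (o2 jf); case: (ext t j).
have d_ge0 (j : 'I_m) : (f j < j)%N -> 0 <= d j.
  by move=> jf; rewrite /d (negPf (cap_close fs (ltn_ord j) jf)); case: (t j).
have rsumB n' : rsum n' t - rsum n' (signs_of m s) =
    \sum_(j : 'I_m | (m - n' <= j)%N && (f j < m - n')%N) d j.
  rewrite /rsum -sumrB (bigID (fun j : 'I_m => (f j < m - n')%N)) /=.
  (* The places whose partner is also in range: exchanging partners negates their sum. *)
  rewrite [X in _ + X](_ : _ = 0) ?addr0; last first.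
    set S := (X in X = _).
    have : S = - S.
      rewrite {1}/S (reindex_inj (inv_inj foK)) /= -sumrN; apply: eq_big => [j|j _].
        by rewrite (capK fs) // -!leqNgt andbC.
      by rewrite !ffunE; exact: dfo.
    lia.
  by apply: eq_bigr => j _; rewrite /d ffunE.
split.
  apply/eqP; rewrite -subr_eq0 rsumB big_pred0 // => j.
  by rewrite subnn ltn0 andbF.
move=> n' _; rewrite -subr_ge0 rsumB; apply: sumr_ge0 => j /andP[h1 h2].
by apply: d_ge0; exact: leq_trans h2 h1.
Qed.

Lemma capvec_is_heart m f s : capped m f s -> is_heart q bar (signs_of m s) (capvec m f s).
Proof.
move=> fs; split; first exact: psi_capvec.
exists (fun t => capvec m f s t - (t == signs_of m s)%:R); split.
- move=> t; have [->|ts] := eqVneq t (signs_of m s); last by rewrite subr0; exact: capvec_coef.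
  by rewrite capvec_diag // subrr; exists 0; rewrite rmorph0 horner0 mulr0.
- move=> t; have [->|ts] := eqVneq t (signs_of m s); first by rewrite capvec_diag // subrr eqxx.
  by rewrite subr0; exact: capvec_dominates.
apply/ffunP => u; rewrite sum_ffunE (bigD1 u) //= big1 => [|t tu].
  by rewrite !ffunE eqxx addr0 -[RHS]/(_ * _) mulr1.
by rewrite !ffunE [u == t]eq_sym (negPf tu) -[LHS]/(_ * _) mulr0.
Qed.

(** Reversing a cap moves its plus sign to the right. *)
Lemma capvec_rank m f s (t : signs m) : capped m f s -> capvec m f s t != 0 ->
  t != signs_of m s ->
  (\sum_(j < m) j * signs_of m s j < \sum_(j < m) j * t j)%N.
Proof.
move=> fs nz ts; pose fo (j : 'I_m) := Ordinal (cap_in fs (ltn_ord j)).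
have foK : involutive fo by move=> j; apply: val_inj; rewrite /= (capK fs).
apply: (@opener_weight_min _ (@nat_of_ord m) fo) => //.
- exact: val_inj.
- move=> j fj; have [h1 _] := capvec_neq0 fs nz (ltn_ord j).
  by rewrite ffunE -(ext_ord t) h1 //; move/(congr1 val): fj.
- move=> j fj; have [_ h2] := capvec_neq0 fs nz (ltn_ord j).
  have fj' : f j <> j by move=> e; apply: fj; apply: val_inj.
  rewrite ffunE -!(ext_ord t) /= h2 //; split=> //.
  have := cap_open fs (ltn_ord j); have := cap_close fs (ltn_ord j).
  by case: (ltngtP j (f j)) => [jf _ -> //|jf /(_ isT) /negPf -> //|e]; case: fj'.
by move=> e; case/eqP: ts; apply/ffunP.
Qed.

End CapVectors.

(** * Diagrams and sign sequences *)

Section Rotation.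
Variables (n k : nat).
Hypothesis kn : (k <= n)%N.

(* Boundary positions counted from the bottom point [k] onwards: there, the
   sources of the arcs are exactly the points labelled [true] by [ptlab]. *)
Definition rotpos (x : pt n) : nat :=
  if (pos x < k)%N then (pos x + (n + n - k))%N else (pos x - k)%N.

Lemma rotpos_lt x : (rotpos x < n + n)%N.
Proof. by have := pos_lt x; rewrite /rotpos; case: ifP; lia. Qed.

Lemma rotpos_inj : injective rotpos.
Proof.
move=> x y e; apply: pos_inj; have := pos_lt x; have := pos_lt y; move: e.
by rewrite /rotpos; do 2![case: ifP]; lia.
Qed.

Lemma rotpos_ltE x y : x != y ->
  (rotpos x < rotpos y)%N = (pos x < pos y)%N (+) (pos x < k)%N (+) (pos y < k)%N.
Proof.
move=> /eqP xy; have : pos x <> pos y by move/pos_inj.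
have := pos_lt x; have := pos_lt y.
by rewrite /rotpos; do 2![case: ifP]; lia.
Qed.

(** Rotation flips the comparison of two points when exactly one of them lies before [k]. In the
    separation identity the flips due to [y] and to [f y] cancel within a side, and those due to [x]
    and [f x] occur on both sides. *)
Lemma rotpos_ncm (f : pt n -> pt n) :
  ncmatching rotpos [set: pt n] f <-> ncmatching (@pos n) [set: pt n] f.
Proof.
have sepE x y : x != y -> f x != y -> f y != x -> f y != f x ->
    ((rotpos x < rotpos y)%N (+) (rotpos (f x) < rotpos y)%N =
     (rotpos x < rotpos (f y))%N (+) (rotpos (f x) < rotpos (f y))%N) <->
    ((pos x < pos y)%N (+) (pos (f x) < pos y)%N =
     (pos x < pos (f y))%N (+) (pos (f x) < pos (f y))%N).
  move=> h1 h2 h3 h4; rewrite !rotpos_ltE // 1?eq_sym //.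
  move: (pos x < pos y)%N (pos (f x) < pos y)%N (pos x < pos (f y))%N => b1 b2 b3.
  move: (pos (f x) < pos (f y))%N (pos x < k)%N (pos y < k)%N (pos (f x) < k)%N => b4 b5 b6 b7.
  by case: (pos (f y) < k)%N b1 b2 b3 b4 b5 b6 b7; do 7!case.
split=> fT; have fK x : f (f x) = x by [apply: (ncmK fT); rewrite inE].
all: have fneq x : f x != x by [apply: (ncm_neq fT); rewrite inE].
all: apply: ncm_of_sep => [//|x _|x _|x y _ _ yx yfx]; rewrite ?inE //.
all: have fyx : f y != x by apply: contra_neq yfx => <-; rewrite fK.
all: have fyfx : f y != f x by rewrite (inj_eq (inv_inj fK)).
all: have := sepE x y; rewrite eq_sym yx eq_sym yfx => /(_ isT isT fyx fyfx) [h1 h2].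
- by apply: h1; apply: (ncm_sep rotpos_inj fT); rewrite ?inE.
- by apply: h2; apply: (ncm_sep (@pos_inj n) fT); rewrite ?inE.
Qed.

End Rotation.

(** * Correspondence between diagrams and sign sequences *)

Section HalfDiagrams.
Variable n : nat.
Notation signs := {ffun 'I_n -> bool}.
Implicit Types (D : diagram n).

(** The top line of [D] alone, with through links as fixed points; [capsg] gives such a point the
    sign of the step vector at its bottom end. *)
Definition capf D (x : nat) : nat :=
  if insub x is Some i then (if D (inr i) is inr j then (j : nat) else x) else x.

Definition capsg k D (x : nat) : bool :=
  if insub x is Some i then
    match D (inr i) with inr j => (i < j)%N | inl j => (k <= j)%N end
  else true.

Lemma capfE D (i : 'I_n) : capf D i = if D (inr i) is inr j then (j : nat) else i.
Proof. by rewrite /capf valK. Qed.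

Lemma capsgE k D (i : 'I_n) : capsg k D i =
  match D (inr i) with inr j => (i < j)%N | inl j => (k <= j)%N end.
Proof. by rewrite /capsg valK. Qed.

(** Through links preserve order because they do not cross, so their signs increase along the top as
    in the step vector. *)
Lemma capf_capped k D : capped n (capf D) (capsg k D).
Proof.
have nc (x y : pt n) := ncm_nc (diagram_ncm D) (in_setT x) (in_setT y).
have swap (x y : pt n) : D x = y -> D y = x by move=> <-; rewrite diagramK.
have neq (i j : 'I_n) : D (inr i) = inr j -> i <> j :> nat.
  by move=> Di /val_inj e; have := diagram_neq D (inr i); rewrite Di e eqxx.
split=> x; last first.
- move=> y xy; have xn : (x < n)%N by lia.
  have yn : (y < n)%N by lia.
  rewrite -[x]/(nat_of_ord (Ordinal xn)) -[y]/(nat_of_ord (Ordinal yn)) !capfE !capsgE.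
  case Dx : (D (inr (Ordinal xn))) => [c|c]; last by move=> e; case: (neq _ _ Dx).
  case Dy : (D (inr (Ordinal yn))) => [d|d]; last by move=> _ e; case: (neq _ _ Dy).
  move=> _ _; have := nc (inl d) (inl c); rewrite (swap _ _ Dx) (swap _ _ Dy) /= => h.
  by have := ltn_ord c; have := ltn_ord d; lia.
- move=> xn; rewrite -[x]/(nat_of_ord (Ordinal xn)) capfE capsgE.
  by case: (D _) => j /=; lia.
- move=> xn; rewrite -[x]/(nat_of_ord (Ordinal xn)) capfE capsgE.
  by case: (D _) => j /=; lia.
- move=> y xn yn; rewrite -[x]/(nat_of_ord (Ordinal xn)) -[y]/(nat_of_ord (Ordinal yn)) !capfE.
  case Dx : (D (inr (Ordinal xn))) => [c|c] /=; first by lia.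
  case Dy : (D (inr (Ordinal yn))) => [d|d] xy e; last by case: (neq _ _ Dy).
  have := ncm_between (@pos_inj n) (diagram_ncm D) (in_setT (inr c)) (in_setT (inr (Ordinal yn))).
  by rewrite (swap _ _ Dx) Dy /=; have := ltn_ord c; have := ltn_ord d; lia.
- move=> y xn yn; rewrite -[x]/(nat_of_ord (Ordinal xn)) -[y]/(nat_of_ord (Ordinal yn)) !capfE.
  case Dx : (D (inr (Ordinal xn))) => [c|c] /=; first by lia.
  case Dy : (D (inr (Ordinal yn))) => [d|d] /=; first by lia.
  have := nc (inr d) (inr c); rewrite (swap _ _ Dx) (swap _ _ Dy) /=.
  by have := ltn_ord c; have := ltn_ord d; lia.
- move=> xn; rewrite -[x]/(nat_of_ord (Ordinal xn)) [capf D (Ordinal xn)]capfE.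
  case Dx : (D (inr (Ordinal xn))) => [c|c]; rewrite capfE; first by rewrite Dx.
  by rewrite (swap _ _ Dx).
by move=> xn; rewrite -[x]/(nat_of_ord (Ordinal xn)) capfE; case: (D _) => j //; exact: ltn_ord.
Qed.

(** A bottom link of [D] straddles [k], so its right end, labelled [true], is met first. A through
    link starts at the bottom if its bottom end is at or beyond [k], and at the top otherwise. The
    top line is read from right to left, which matches the negated labels there. *)
Lemma rotpos_opener k D : (k <= n)%N -> ind_diagram k D -> forall x,
  ptlab (signs_of n (capsg k D)) [ffun i : 'I_n => (k <= i)%N] x =
    (rotpos k x < rotpos k (D x))%N.
Proof.
move=> kn /ind_diagramP kD [i|i]; rewrite /= ffunE.
  case Di : (D (inl i)) => [j|j]; rewrite /rotpos /=.
    have [h1 h2] := kD i j Di; have := ltn_ord i; have := ltn_ord j.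
    by repeat case: ifP; lia.
  by have := ltn_ord i; have := ltn_ord j; repeat case: ifP; lia.
rewrite capsgE; have ne := diagram_neq D (inr i).
case Di : (D (inr i)) ne => [j|j] ne; rewrite /rotpos /=; have := ltn_ord i; have := ltn_ord j.
  by repeat case: ifP; lia.
have : j <> i :> nat by move=> /val_inj e; rewrite e eqxx in ne.
by repeat case: ifP; lia.
Qed.

Lemma sum_alternating D (l : pt n -> bool) : (forall x, l (D x) = ~~ l x) ->
  (\sum_x l x = n)%N.
Proof.
move=> lD; apply: double_inj; rewrite -addnn.
rewrite {2}(reindex_inj (inv_inj (@diagramK _ D))) -big_split /=.
rewrite (eq_bigr (fun=> 1%N)) => [|x _]; last by rewrite lD; case: (l x).
by rewrite sum1_card card_sum card_ord addnn.
Qed.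

Lemma sum_step k m : (\sum_(i < m) (k <= i) = m - k)%N.
Proof. by elim: m => [|m IH]; rewrite ?big_ord0 // big_ord_recr /= IH; case: leqP; lia. Qed.

Lemma sum_ptlab k (s : signs) :
  (\sum_x ptlab s [ffun i : 'I_n => (k <= i)%N] x = n - k + \sum_i ~~ s i)%N.
Proof.
rewrite big_sumType /=; congr (_ + _)%N.
by rewrite -sum_step; apply: eq_bigr => i _; rewrite ffunE.
Qed.

Lemma rotpos_alternate k D x : (k <= n)%N ->
  (rotpos k (D x) < rotpos k (D (D x)))%N = ~~ (rotpos k x < rotpos k (D x))%N.
Proof.
move=> kn; rewrite diagramK; have ne := diagram_neq D x.
by case: ltngtP => // /(rotpos_inj kn) e; rewrite e eqxx in ne.
Qed.

(** Half of the [2n] points are openers, which forces [k] to be the number of minus signs; then the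
    openers determine the matching. *)
Lemma half_diagram_inj k k' D D' : (k <= n)%N -> (k' <= n)%N ->
  ind_diagram k D -> ind_diagram k' D' ->
  signs_of n (capsg k D) = signs_of n (capsg k' D') -> k = k' /\ D = D'.
Proof.
move=> kn kn' kD kD' ss'.
have count j E : (j <= n)%N -> ind_diagram j E ->
    (n - j + \sum_i ~~ signs_of n (capsg j E) i = n)%N.
  move=> jn jE; rewrite -sum_ptlab; apply: (@sum_alternating E) => x.
  by rewrite !(rotpos_opener jn jE) rotpos_alternate.
have kk' : k = k'.
  by have := count _ _ kn kD; have := count _ _ kn' kD'; rewrite ss'; lia.
split=> //; subst k'; apply: val_inj; apply/ffunP => x.
have rD := (rotpos_ncm kn D).2 (diagram_ncm D).
have rD' := (rotpos_ncm kn D').2 (diagram_ncm D').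
apply: (ncm_unique (rotpos_inj kn) rD rD'); rewrite ?inE // => y _.
by rewrite -(rotpos_opener kn kD) ss' (rotpos_opener kn kD').
Qed.

(** With [k] the number of minus signs, the rotated word has [n] openers. It begins with [n - k]
    openers, ends with [k] closers, and has at most [n - k] closers before those, so it is a Dyck
    word. *)
Lemma half_diagram_surj (s : signs) : exists (k : 'I_n.+1) D,
  ind_diagram k D /\ signs_of n (capsg k D) = s.
Proof.
pose k := (\sum_i ~~ s i)%N.
have kP : (\sum_i s i + k = n)%N.
  rewrite -big_split /= (eq_bigr (fun=> 1%N)) => [|i _]; last by case: (s i).
  by rewrite sum1_card card_ord.
have kn : (k <= n)%N by lia.
pose rot (x : pt n) := Ordinal (rotpos_lt kn x).
have rot_inj : injective rot by move=> x y [/(rotpos_inj kn)].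
have [unrot rotK unrotK] : bijective rot.
  by apply: inj_card_bij; rewrite // card_sum !card_ord.
pose lab := ptlab s [ffun i : 'I_n => (k <= i)%N].
pose u (p : nat) := if insub p is Some i then lab (unrot i) else false.
have uE x : u (rotpos k x) = lab x.
  by rewrite /u -[rotpos k x]/(val (rot x)) valK rotK.
have prefix m : (m <= n + n)%N -> forall G : nat -> nat,
    (\sum_(p < m) G p = \sum_(x : pt n | (rotpos k x < m)%N) G (rotpos k x))%N.
  move=> mn G; rewrite (big_ord_widen _ G mn) (reindex rot).
  - by [].
  by apply: onW_bij; exists unrot.
have labT : (\sum_x lab x = n)%N by rewrite sum_ptlab -/k; lia.
have rl i : rotpos k (inl i : pt n) = (if i < k then i + (n + n - k) else i - k)%N by [].
have rr i : rotpos k (inr i : pt n) = (n + (n - i.+1) - k)%N.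
  by rewrite /rotpos /= ifF //; apply/negbTE; rewrite -leqNgt (leq_trans kn) ?leq_addr.
have opens m : (m <= n + n)%N ->
    (\sum_(p < m) u p = \sum_(x : pt n | (rotpos k x < m)%N) lab x)%N.
  by move=> mn; rewrite (prefix m mn u); apply: eq_bigr => x _; rewrite uE.
have closes m : (m <= n + n)%N ->
    (m = \sum_(x : pt n | (rotpos k x < m)%N) lab x +
         \sum_(x : pt n | (rotpos k x < m)%N) ~~ lab x)%N.
  move=> mn; rewrite -big_split /= (eq_bigr (fun=> 1%N)) => [|x _]; last by case: (lab x).
  by rewrite -(prefix m mn (fun=> 1%N)) sum1_card card_ord.
have [f [fP fu fnc]] : exists f : nat -> nat,
  [/\ forall x, (x < n + n)%N -> [/\ (f x < n + n)%N, f (f x) = x & f x <> x],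
      forall x, (x < n + n)%N -> u x = (x < f x)%N &
      forall x y, (x < n + n)%N -> (y < n + n)%N -> ~ (x < y < f x /\ f x < f y)%N].
  apply: dyck_matching => [m mn|]; last first.
    rewrite opens // -addnn (eq_bigl xpredT) ?labT // => x.
    exact: rotpos_lt.
  (* Beyond position [2n - k] only bottom points left of [k] remain; they are closers, so all [n]
     openers have been read. *)
  rewrite opens //; case: (leqP m (n + n - k)) => mk; last first.
    rewrite big_mkcond /= (eq_bigr (fun x => nat_of_bool (lab x))) => [|x _].
      by rewrite labT -addnn.
    case: ifP => // /negbT; rewrite -leqNgt; case: x => i.
      by rewrite rl /= ffunE => h; have := ltn_ord i; move: h; case: (ltnP i k); lia.
    by rewrite rr; have := ltn_ord i; lia.
  have := closes m mn; set O := (X in X.*2); set C := (X in _ = (_ + X)%N).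
  suff : (C <= O)%N by lia.
  have CE : C = (\sum_(i | (rotpos k (inr i : pt n) < m)%N) s i)%N.
    rewrite /C big_sumType /= big1 ?add0n => [|i].
      by apply: eq_bigr => i _; rewrite negbK.
    by rewrite rl ffunE; case: (ltnP i k) => // ik h; have := ltn_ord i; lia.
  have Cle : (C <= n - k)%N.
    have -> : (n - k = \sum_i s i)%N by lia.
    by rewrite CE [leqRHS](bigID (fun i => (rotpos k (inr i : pt n) < m)%N)) leq_addr.
  (* The first [n - k] positions are the bottom points from [k] on, all openers; a shorter prefix
     contains no closer. *)
  case: (leqP (n - k) m) => nkm.
    apply: leq_trans Cle _; rewrite /O big_sumType /=; apply: leq_trans (leq_addr _ _).
    rewrite -sum_step big_mkcond /= [leqRHS]big_mkcond; apply: leq_sum => i _.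
    rewrite rl ffunE /=; have := ltn_ord i.
    by case: (leqP k i) => ki; case: ifP => //; lia.
  by rewrite CE big1 // => i; rewrite rr; have := ltn_ord i; lia.
(* [f] stays below [2n], so the default of [insubd] is never taken. *)
pose f0 := [ffun x : pt n => unrot (insubd (rot x) (f (rotpos k x)))].
have f0E x : rotpos k (f0 x) = f (rotpos k x).
  rewrite ffunE -[rotpos k (unrot _)]/(val (rot (unrot _))) unrotK insubdK //.
  by have [] := fP _ (rotpos_lt kn x).
have f0r : ncmatching (rotpos k) [set: pt n] f0.
  split=> [//|x _|x _|x y _ _]; have [h1 h2 h3] := fP _ (rotpos_lt kn x).
  - by apply: (rotpos_inj kn); rewrite !f0E.
  - by apply/eqP => e; apply: h3; rewrite -f0E e.
  - by rewrite !f0E; apply: fnc; exact: rotpos_lt.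
pose D := Diagram (ncm_is_diagram ((rotpos_ncm kn f0).1 f0r)).
have labE x : lab x = (rotpos k x < rotpos k (D x))%N.
  by rewrite -uE fu ?rotpos_lt //= f0E.
have kD : ind_diagram k D.
  (* Linked points have opposite labels, while bottom points on the same side of [k] have equal
     ones. *)
  apply/ind_diagramP => i j Dij; have := rotpos_alternate D (inl i) kn.
  rewrite -!labE Dij /= !ffunE; split; lia.
have kn1 : (k < n.+1)%N by [].
exists (Ordinal kn1), D; split=> //=; apply/ffunP => i.
have := rotpos_opener kn kD (inr i); rewrite -labE /=.
by move/negb_inj.
Qed.

Lemma tlact_capvec (K : fieldType) (q : K) k D : q != 0 -> (k <= n)%N ->
  ind_diagram k D ->
  tlact q (diagTL K D) (stepv K n k) = capvec q n (capf D) (capsg k D).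
Proof.
move=> q0 kn /ind_diagramP kD; apply/ffunP => s; rewrite ffunE.
set t := [ffun i : 'I_n => (k <= i)%N].
rewrite (bigD1 t) //= big1 => [|u ut]; last by rewrite ffunE (negPf ut) mulr0.
rewrite ffunE eqxx mulr1 addr0 opmx_diag ffunE /diagmx.
pose open x := (pos x < pos (D x))%N.
have openD x : open (D x) = ~~ open x.
  rewrite /open diagramK; have ne := diagram_neq D x.
  by case: ltngtP => // /pos_inj e; rewrite e eqxx in ne.
pose l := ptlab s t.
pose G (x : pt n) : K := if x is inr i then gluew q (s i) else 1.
pose a x : K := (if open x then arcw q (l x) (l (D x)) else arcw q (l (D x)) (l x)) *
  (G x * G (D x)).
have aD x : a (D x) = a x.
  by rewrite /a openD diagramK [G (D x) * _]mulrC; case: (open x).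
(* Each arc is counted at its source; counting it instead at its left end if it
   is a cup or a cap, and at its top end if it is a through link, gives [capw]. *)
pose first (x y : pt n) : bool := match x, y with
  | inl i, inl j => (i < j)%N | inr i, inr j => (i < j)%N
  | inr _, inl _ => true | inl _, inr _ => false end.
pose sel x := first x (D x).
have selD x : sel (D x) = ~~ sel x.
  rewrite /sel diagramK; have := diagram_neq D x; case: (D x) => j; case: x => i //= ne.
    by case: ltngtP => // /val_inj e; rewrite e eqxx in ne.
  by case: ltngtP => // /val_inj e; rewrite e eqxx in ne.
have move_sel : \prod_(x | open x) a x = \prod_(x | sel x) a x.
  rewrite (bigID sel) [RHS](bigID open) /=; congr (_ * _).
    by apply: eq_bigl => x; rewrite andbC.
  rewrite (reindex_inj (inv_inj (@diagramK _ D))) /=; apply: eq_big => [x|x _]; last exact: aD.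
  by rewrite openD selD negbK andbC.
have -> : (\prod_i gluew q (s i)) = \prod_(x | open x) (G x * G (D x)).
  transitivity (\prod_x G x).
    by rewrite big_sumType /= [X in _ = X * _]big1 ?mul1r.
  rewrite (bigID open) /= big_split /=; congr (_ * _).
  rewrite (reindex_inj (inv_inj (@diagramK _ D))) /=; apply: eq_bigl => x.
  by rewrite openD negbK.
have -> : matchw (@pos n) q [set: pt n] D l = \prod_(x | open x) arcw q (l x) (l (D x)).
  rewrite /matchw [RHS]big_mkcond; apply: eq_big => [x|x _]; rewrite ?inE //.
transitivity (\prod_(x | open x) a x).
  by rewrite -big_split; apply: eq_bigr => x ox; rewrite /a ox /= mulrC.
rewrite move_sel big_mkcond big_sumType /= big1 ?mul1r => [|i _].
  apply: eq_bigr => i _; rewrite /sel /first /a /capw capfE capsgE /G /l /open.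
  case Di : (D (inr i)) => [j|j] /=; rewrite /t ?ffunE.
    rewrite ltnn eqxx ext_ord ltnNge ltnW /=; last by have := ltn_ord i; have := ltn_ord j; lia.
    by case: (s i) (k <= j)%N => [] []; rewrite /arcw /gluew /=; field.
  case: ltnP => ij; last first.
    rewrite ifF // ; apply/eqP => /val_inj e.
    by have := diagram_neq D (inr i); rewrite Di e eqxx.
  rewrite !ext_ord ltnNge ltnW /=; last by have := ltn_ord i; have := ltn_ord j; lia.
  by case: (s i) (s j) => [] []; rewrite /arcw /gluew /=; field.
rewrite /sel /first /a /G /l /open; case Di : (D (inl i)) => [j|j] //=.
(* A cup straddles [k] and pairs v_- with v_+, where [eps] is 1; hence no scalar appears in the
   image. *)
case: ifP => // ij; have [h1 h2] := kD i j Di.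
have ki : (k <= i)%N = false by lia.
have kj : (k <= j)%N by lia.
by rewrite /t !ffunE ki kj ij /arcw /= !mul1r.
Qed.

End HalfDiagrams.

(** * Dual canonical basis *)

Lemma linear_inj_surj (K : fieldType) (vT : vectType K) (f : {linear vT -> vT}) :
  (forall v, f v = 0 -> v = 0) -> forall w, exists v, w = f v.
Proof.
move=> f0 w; have : w \in limg (linfun f).
  rewrite lker0_limgf ?memvf //; apply/eqP/vspaceP => v.
  rewrite memv0 memv_ker lfunE; apply/eqP/eqP => [/f0 //|->].
  exact: linear0.
by case/memv_imgP => v _ ->; exists v; rewrite lfunE.
Qed.

Section HeartBasis.
Variables (K : fieldType) (q : K) (bar : {rmorphism K -> K}) (n : nat).
Hypotheses (q0 : q != 0) (barq : bar q = q^-1).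
Hypothesis bar_fixed : forall a, bar a = a -> qinvZ q a -> a = 0.
Notation signs := {ffun 'I_n -> bool}.
Notation tens := (tens K n).
Implicit Types (s t : signs) (D : diagram n) (c : {ffun signs -> K^o}).

Definition half_k s : 'I_n.+1 := projT1 (cid (half_diagram_surj s)).
Definition half_D s : diagram n := projT1 (cid (projT2 (cid (half_diagram_surj s)))).

Lemma half_kD s : ind_diagram (half_k s) (half_D s) /\
  signs_of n (capsg (half_k s) (half_D s)) = s.
Proof. exact: projT2 (cid (projT2 (cid (half_diagram_surj s)))). Qed.

Lemma half_k_leq s : (half_k s <= n)%N.
Proof. by rewrite -ltnS. Qed.

Lemma half_signs_of (k : 'I_n.+1) D : ind_diagram k D ->
  half_k (signs_of n (capsg k D)) = k /\ half_D (signs_of n (capsg k D)) = D.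
Proof.
move=> kD; have [kD' e] := half_kD (signs_of n (capsg k D)).
have kn : (k <= n)%N by rewrite -ltnS.
by have [/val_inj] := half_diagram_inj (half_k_leq _) kn kD' kD e.
Qed.

Definition heartv s : tens := capvec q n (capf (half_D s)) (capsg (half_k s) (half_D s)).

Lemma heartv_is_heart s : is_heart q bar s (heartv s).
Proof.
have [_ e] := half_kD s; rewrite -[s in is_heart _ _ s]e.
exact/capvec_is_heart/capf_capped.
Qed.

Definition heartsum c : tens := \sum_s c s *: heartv s.

Fact heartsum_linear : linear heartsum.
Proof.
move=> a c d; rewrite /heartsum scaler_sumr -big_split; apply: eq_bigr => s _ /=.
by rewrite !ffunE scalerDl scalerA.
Qed.

HB.instance Definition _ := GRing.isLinear.Build K {ffun signs -> K^o}
  {ffun signs -> K^o} *:%R (heartsum : {ffun signs -> K^o} -> {ffun signs -> K^o})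
  heartsum_linear.

Lemma heartv_diag s : heartv s s = 1.
Proof.
have [_ e] := half_kD s; have := capvec_diag q (capf_capped (half_k s) (half_D s)).
by rewrite e.
Qed.

Lemma heartv_rank s t : s != t -> heartv s t != 0 ->
  (\sum_(j < n) j * s j < \sum_(j < n) j * t j)%N.
Proof.
move=> st nz; have [_ e] := half_kD s.
have := capvec_rank (capf_capped (half_k s) (half_D s)) nz.
by rewrite e eq_sym => /(_ st).
Qed.

Lemma heartsum_coef c t : heartsum c t = \sum_s c s * heartv s t.
Proof. by rewrite sum_ffunE; apply: eq_bigr => s _; rewrite ffunE. Qed.

Lemma heartsum_eq0 c : heartsum c = 0 -> c = 0.
Proof.
move=> c0; apply/ffunP => s; rewrite [RHS]ffunE; move: s.
apply: (@triangular_free _ _ (fun s : signs => \sum_(j < n) j * s j)%N (fun s t => heartv s t)).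
- by move=> s; rewrite heartv_diag oner_neq0.
- exact: heartv_rank.
by move=> t; rewrite -heartsum_coef c0 ffunE.
Qed.

(** Indexing the cap vectors by sign sequences makes [heartsum] an endomorphism of a
    finite-dimensional space, so injectivity suffices. *)
Lemma heartsum_surj (v : tens) : exists c, v = heartsum c.
Proof. exact: (linear_inj_surj (f := heartsum) heartsum_eq0). Qed.

Lemma qinvZB a b : qinvZ q a -> qinvZ q b -> qinvZ q (a - b).
Proof.
move=> [f ->] [g ->]; exists (f - g).
by rewrite rmorphB hornerD hornerN mulrBr.
Qed.

(* A bar invariant vector is a combination of the [heartv s] with bar invariant
   coefficients, and the lowest of them is one of its coordinates. *)
Lemma is_heart_unique s (x y : tens) :
  is_heart q bar s x -> is_heart q bar s y -> x = y.
Proof.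
move=> [psx [cx [cxq _ xE]]] [psy [cy [cyq _ yE]]].
have [c cE] := heartsum_surj (x - y).
have coefq t : qinvZ q (heartsum c t).
  have -> : heartsum c t = cx t - cy t.
    have coefE (d : signs -> K) : (\sum_l d l *: vtens K l : tens) t = d t.
      rewrite sum_ffunE (bigD1 t) //= big1 ?addr0 => [|l lt].
        by rewrite !ffunE eqxx -[LHS]/(_ * _) mulr1.
      by rewrite !ffunE [t == l]eq_sym (negPf lt) -[LHS]/(_ * _) mulr0.
    have -> : heartsum c = (x - vtens K s) - (y - vtens K s).
      by rewrite -cE opprB addrA subrK.
    by rewrite xE yE !ffunE !coefE.
  exact: qinvZB.
have psiE : psi q bar (heartsum c) = heartsum [ffun s => bar (c s)].
  rewrite /heartsum (big_morph _ (@psiD _ q bar n) (psi0 q bar n)).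
  apply: eq_bigr => t _; rewrite psiZ ffunE; congr (_ *: _).
  by have [] := heartv_is_heart t.
have barc t : bar (c t) = c t.
  have : heartsum ([ffun s => bar (c s)] - c) = 0.
    rewrite linearB /=; apply/eqP; rewrite subr_eq0 -psiE -cE -scaleN1r psiD psiZ.
    by rewrite rmorphN rmorph1 psx psy.
  move/heartsum_eq0 => /ffunP /(_ t); rewrite !ffunE => /eqP.
  by rewrite subr_eq0 => /eqP.
suff c0 : c = 0 by apply/eqP; rewrite -subr_eq0 cE c0 linear0.
apply/ffunP => t; rewrite [RHS]ffunE.
have [m] := ubnP (\sum_(j < n) j * t j)%N; elim: m t => // m IH t tm.
apply: bar_fixed; first exact: barc.
have -> : c t = heartsum c t; last exact: coefq.
rewrite heartsum_coef (bigD1 t) //= heartv_diag mulr1 big1 ?addr0 // => u ut.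
have [->|nz] := eqVneq (heartv u t) 0; first by rewrite mulr0.
by rewrite IH ?mul0r // (leq_trans (heartv_rank ut nz)).
Qed.

(** [heart] is a chosen element of a set, so it is identified by exhibiting a member and proving it
    the only one. *)
Lemma heartE s : heart q bar s = heartv s.
Proof.
apply: xget_unique => [|y]; first exact: heartv_is_heart.
by move/is_heart_unique; apply; exact: heartv_is_heart.
Qed.

Hypothesis beta0 : beta q != 0.

Definition halfvec (k : 'I_n.+1) D : IndSum q n :=
  IndSum_of (fun k' => if k' == k then tens1 q k' (diagTL K D) else 0).

Lemma indmap0 k : indmap (0 : Ind q n k) = 0.
Proof.
by have := indmap_linear q0 (-1) (0 : Ind q n k) 0; rewrite scaler0 addr0 scaleN1r addNr.
Qed.

Lemma indsum_map_half (k : 'I_n.+1) D m : ind_diagram k D ->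
  Defs.comp m k = tens1 q k (diagTL K D) -> (forall k', k' <> k -> Defs.comp m k' = 0) ->
  indsum_map m = heartv (signs_of n (capsg k D)).
Proof.
move=> kD mk mk'; rewrite /indsum_map (bigD1 k) //= big1 ?addr0 => [|k' /eqP /mk' ->]; last first.
  exact: indmap0.
have kn : (k <= n)%N by rewrite -ltnS.
rewrite mk indmap_tens1 // tlact_capvec // /heartv.
by have [-> ->] := half_signs_of kD.
Qed.

Lemma half_reindex (F : 'I_n.+1 -> diagram n -> tens) :
  \sum_(k < n.+1) \sum_(D | ind_diagram k D) F k D = \sum_s F (half_k s) (half_D s).
Proof.
rewrite pair_big_dep /= (reindex_onto (fun s => (half_k s, half_D s))
  (fun p => signs_of n (capsg p.1 p.2))) /= => [|[k D] /= kD]; last first.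
  by have [-> ->] := half_signs_of kD.
by apply: eq_bigl => s; have [-> ->] := half_kD s; rewrite eqxx.
Qed.

(** Each component is expanded in the spanning family [D (x) 1]; distinct pairs [(k, D)] give
    distinct sign sequences, so the coefficients become those of a free family. *)
Lemma indsum_map_inj : injective (@indsum_map K q n).
Proof.
suff h (m : IndSum q n) : indsum_map m = 0 -> m = 0.
  move=> m1 m2 e; apply/eqP; rewrite -subr_eq0; apply/eqP/h.
  by rewrite -scaleN1r addrC indsum_map_linear // e scaleN1r addNr.
pose y (k : 'I_n.+1) : TL K n := repr (Defs.comp m k : Quotient.quot (bal q k)).
have mE (k : 'I_n.+1) : Defs.comp m k =
    \sum_(D | ind_diagram k D) coefTL (y k) D *: tens1 q k (diagTL K D).
  by rewrite -tens1_expand // tens1K.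
pose c : {ffun signs -> K^o} := [ffun s => coefTL (y (half_k s)) (half_D s)].
have -> : indsum_map m = heartsum c.
  transitivity (\sum_(k < n.+1) \sum_(D | ind_diagram k D)
      coefTL (y k) D *: heartv (signs_of n (capsg k D))).
    apply: eq_bigr => k _; rewrite mE.
    rewrite (big_morph (@indmap K q n k) (id1 := 0) (op1 := +%R)); first last.
    - exact: indmap0.
    - by move=> u v; have := indmap_linear q0 1 u v; rewrite !scale1r.
    apply: eq_bigr => D kD; have kn : (k <= n)%N by rewrite -ltnS.
    have := indmap_linear q0 (coefTL (y k) D) (tens1 q k (diagTL K D)) 0.
    rewrite indmap0 !addr0 => ->; rewrite indmap_tens1 // tlact_capvec // /heartv.
    by have [-> ->] := half_signs_of kD.
  rewrite (half_reindex (fun k D => coefTL (y k) D *: heartv (signs_of n (capsg k D)))).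
  by apply: eq_bigr => s _; have [_ ->] := half_kD s; rewrite ffunE.
move/heartsum_eq0 => /ffunP c0; apply: IndSum_eqP => k; rewrite mE [RHS]comp_of big1 // => D kD.
have := c0 (signs_of n (capsg k D)); rewrite !ffunE.
by have [-> ->] := half_signs_of kD => ->; rewrite scale0r.
Qed.

Lemma halfvec_map (k : 'I_n.+1) D : ind_diagram k D ->
  indsum_map (halfvec k D) = heartv (signs_of n (capsg k D)).
Proof.
move=> kD; apply: indsum_map_half => //; first by rewrite comp_of eqxx.
by move=> k' /eqP /negPf kk'; rewrite comp_of kk'.
Qed.

Lemma indsum_map_surj (v : tens) : exists m : IndSum q n, indsum_map m = v.
Proof.
have [c ->] := heartsum_surj v.
exists (\sum_s (c s : K) *: halfvec (half_k s) (half_D s)).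
have add (m1 m2 : IndSum q n) : indsum_map (m1 + m2) = indsum_map m1 + indsum_map m2.
  by have := indsum_map_linear q0 1 m1 m2; rewrite !scale1r.
have map0 : indsum_map (0 : IndSum q n) = 0.
  by have := indsum_map_linear q0 (-1) (0 : IndSum q n) 0; rewrite scaler0 addr0 scaleN1r addNr.
rewrite (big_morph _ add map0); apply: eq_bigr => s _.
have := indsum_map_linear q0 (c s) (halfvec (half_k s) (half_D s)) 0.
rewrite map0 !addr0 => ->; have [kD e] := half_kD s.
by rewrite halfvec_map // e.
Qed.

Lemma indsum_map_bij : bijective (@indsum_map K q n).
Proof.
have surj (v : tens) : exists m : IndSum q n, indsum_map m == v.
  by have [m <-] := indsum_map_surj v; exists m.
exists (fun v => xchoose (surj v)) => [m|v]; last exact/eqP/(xchooseP (surj v)).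
by apply: indsum_map_inj; exact/eqP/(xchooseP (surj _)).
Qed.

Local Open Scope classical_set_scope.

Lemma indsum_map_basis :
  @indsum_map K q n @` diagrammatic_basis q n = dual_canonical_basis q bar n.
Proof.
apply/seteqP; split=> [_ [m [k [D [/ind_diagramP kD mk mk']]] <-]|_ [s _ <-]].
  by exists (signs_of n (capsg k D)) => //; rewrite heartE (indsum_map_half kD).
have [kD e] := half_kD s; exists (halfvec (half_k s) (half_D s)); last first.
  by rewrite heartE halfvec_map // e.
exists (half_k s), (half_D s); split; first exact/ind_diagramP.
  by rewrite comp_of eqxx.
by move=> k' /eqP /negPf kk'; rewrite comp_of kk'.
Qed.

End HeartBasis.

(** * Bar invariance and the loop value in C(q) *)

Section Scalars.
Variable R : realType.

Lemma at_qinv_shift (p : {poly R[i]}) :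
  at_qinv p * q R ^+ size p = tofrac (\sum_(i < size p) p`_i *: 'X^(size p - i)).
Proof.
rewrite /at_qinv horner_poly mulr_suml rmorph_sum /=; apply: eq_bigr => i _.
rewrite -mul_polyC rmorphM rmorphXn -/(cst _) -/(q R) -mulrA; congr (_ * _).
have -> : q R ^+ size p = q R ^+ (size p - i) * q R ^+ i.
  by rewrite -exprD subnK // ltnW.
by rewrite mulrCA -exprMn mulVf ?q_neq0 // expr1n mulr1.
Qed.

(** Write [a = h(q^-1)] with [h] divisible by ['X]; bar invariance says [h(q) = h(q^-1)]. After
    multiplication by [q ^+ size h] the left side has only degrees above [size h] and the right side
    only degrees up to [size h]. *)
Lemma qinvZ_bar_fixed (a : KK R) : bar a = a -> qinvZ (q R) a -> a = 0.
Proof.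
move=> + [f aE]; pose h : {poly R[i]} := 'X * map_poly intr f.
have {}aE : a = bar (tofrac h).
  rewrite bar_tofrac at_qinvM aE /at_qinv map_polyX hornerX; congr (_ * _.[_]).
  by rewrite -map_poly_comp; apply: eq_map_poly => z /=; rewrite rmorph_int.
rewrite aE barK bar_tofrac => hE.
have : tofrac (h * 'X^(size h)) = tofrac (\sum_(i < size h) h`_i *: 'X^(size h - i)).
  by rewrite -at_qinv_shift -hE rmorphM rmorphXn.
move/eqP; rewrite tofrac_eq => /eqP hP.
suff -> : h = 0 by apply/eqP; rewrite at_qinv_eq0.
apply/polyP => -[|j]; first by rewrite coef0 coefXM.
have := congr1 (fun r : {poly _} => r`_(size h + j.+1)) hP.
rewrite coefMXn ifF ?addKn; last by apply/negbTE; rewrite -leqNgt leq_addr.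
move=> ->; rewrite coef0 coef_sum big1 // => i _; rewrite coefZ coefXn.
by rewrite (_ : _ == _ = false) ?mulr0 //; apply/negbTE; lia.
Qed.

Lemma beta_neq0 : beta (q R) != 0.
Proof.
rewrite /beta -opprD oppr_eq0; apply/eqP => e.
have : tofrac ('X^2 + 1 : {poly R[i]}) == 0.
  by rewrite rmorphD rmorphXn rmorph1 -/(q R) -(mulfV (q_neq0 R)) expr2 -mulrDr e mulr0.
rewrite tofrac_eq0 => /eqP /(congr1 (horner^~ 0)).
by rewrite hornerD hornerXn expr0n /= add0r hornerC horner0 => /eqP; rewrite oner_eq0.
Qed.

End Scalars.

Local Open Scope classical_set_scope.

Theorem proposition7p11 (R : realType) (n : nat) (hn : (1 <= n)%N) :
  exists act : TL (KK R) n -> tens (KK R) n -> tens (KK R) n,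
    [/\ TLmodule (q R) act,
        forall (i : 'I_n.-1) (x : tens (KK R) n),
          act (eTL i) x = e_tens (q R) i x,
        TLmodule (q R) (IndSum_act (q R) (n:=n)) &
        exists phi : {linear IndSum (q R) n -> tens (KK R) n},
          [/\ bijective phi,
              forall (x : TL (KK R) n) (m : IndSum (q R) n),
                phi (IndSum_act (q R) x m) = act x (phi m) &
              phi @` diagrammatic_basis (q R) n =
                dual_canonical_basis (q R) (@bar R) n]].
Proof.
have q0 := q_neq0 R; have barq := bar_q R.
pose phi : {linear IndSum (q R) n -> tens (KK R) n} :=
  HB.pack (@indsum_map _ (q R) n)
    (GRing.isLinear.Build _ _ _ _ (@indsum_map _ (q R) n) (indsum_map_linear q0)).
exists (@tlact _ (q R) n); split.
- exact: tlact_module.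
- exact: tlact_e.
- exact: IndSum_module.
exists phi; split.
- exact: indsum_map_bij q0 (@beta_neq0 R).
- exact: indsum_map_act.
exact: (@indsum_map_basis _ _ (@bar R) n q0 barq (@qinvZ_bar_fixed R)).
Qed.
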